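(* There is an absolute constant $C>0$ such that the following holds. Let $k\in\mathbb{N}$ and $\epsilon,\delta\in[0,1)$. For any weighted undirected graph on vertex set $V$ with $n=|V|$ and any $S\subseteq V$, there is an $(\epsilon,\delta)$-DP algorithm for the $S$-pair shortest path distances problem that is $\left(2k-1,\ C\,\frac{k^{3/2}\log^{3/2} n\sqrt{|S|^{1+1/k}\log(1/\delta)}}{\epsilon}\right)$-accurate with high probability.
   Context: A weighted undirected graph is $G=(V,E,\mathbf{w})$ with real (nonnegative) edge weights $\mathbf{w}\in\mathbb{R}^E$; $\mathrm{dist}_G(u,v)$ denotes the minimum total weight of a path from $u$ to $v$ in $G$. The underlying graph $(V,E)$ is fixed and public; the private input is $\mathbf{w}$, and two weight vectors $\mathbf{w},\mathbf{w}'$ on the same $(V,E)$ are neighbors if $\|\mathbf{w}-\mathbf{w}'\|_1\le 1$. A randomized algorithm $\mathcal{M}$ is $(\epsilon,\delta)$-DP if for all neighboring $\mathbf{w},\mathbf{w}'$ and every set $O$ of outputs, $\Pr[\mathcal{M}(\mathbf{w})\in O]\le e^{\epsilon}\Pr[\mathcal{M}(\mathbf{w}')\in O]+\delta$. For $S\subseteq V$, the $S$-pair shortest path distances problem asks to output estimates $\tilde d(u,v)$ of $\mathrm{dist}_G(u,v)$ (distance in the whole graph $G$) for all $u,v\in S$; an output is $(\gamma,\alpha)$-accurate if $\mathrm{dist}_G(u,v)-\alpha\le\tilde d(u,v)\le\gamma\cdot\mathrm{dist}_G(u,v)+\alpha$ for all $u,v\in S$. ''With high probability'' means with probability $1-o(1)$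 as $n\to\infty$. *)

(* Defs.v *)
From mathcomp Require Import all_boot all_order all_algebra.
From mathcomp Require Import all_classical all_reals all_analysis.
From mathcomp Require Import measurable_realfun.

Set Implicit Arguments.
Unset Strict Implicit.
Unset Printing Implicit Defensive.

Import Order.TTheory GRing.Theory Num.Theory.
Import numFieldNormedType.Exports.

Local Open Scope classical_set_scope.
Local Open Scope ring_scope.

(* A simple undirected graph on V is given by its edge set E : {set {set V}},  *)
(* all of whose members have exactly two elements.                             *)
Definition edge_set (V : finType) (E : {set {set V}}) : Prop :=
  forall e : {set V}, e \in E -> #|e| = 2%N.

Definition weights (R : realType) (V : finType) (E : {set {set V}}) : Type :=
  {e : {set V} | e \in E} -> R.

(* The default 0 is never used below: every step of a path is an edge.         *)
Definition step_weight (R : realType) (V : finType) (E : {set {set V}})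
    (w : weights R E) (x y : V) : R :=
  if insub [set x; y]%SET is Some e then w e else 0.

(* The sequence u :: p lists the vertices of a simple path from u to v.        *)
Definition is_path (V : finType) (E : {set {set V}}) (u v : V) (p : seq V) : Prop :=
  [/\ path (fun x y => [set x; y]%SET \in E) u p, uniq (u :: p) & last u p = v].

Definition path_weight (R : realType) (V : finType) (E : {set {set V}})
    (w : weights R E) (u : V) (p : seq V) : R :=
  \sum_(c <- pairmap (step_weight w) u p) c.

(* There are finitely many simple paths, so the infimum is a minimum; it is    *)
(* +oo when u and v are not connected.                                         *)
Definition dist (R : realType) (V : finType) (E : {set {set V}})
    (w : weights R E) (u v : V) : \bar R :=
  ereal_inf [set (path_weight w u p)%:E | p in [set p | is_path E u v p]].

Definition nonneg_weights (R : realType) (V : finType) (E : {set {set V}})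
    (w : weights R E) : Prop :=
  forall e, 0 <= w e.

Definition neighbors (R : realType) (V : finType) (E : {set {set V}})
    (w w' : weights R E) : Prop :=
  \sum_e `|w e - w' e| <= 1.

(* One estimate for each pair of vertices of S; estimates are extended reals   *)
(* since distances may be infinite.                                            *)
Definition estimates (R : realType) (V : finType) (S : {set V}) : Type :=
  {u : V | u \in S} * {v : V | v \in S} -> \bar R.

Definition cylinders (R : realType) (V : finType) (S : {set V}) :
    set (set (estimates R S)) :=
  [set A | exists (uv : {u : V | u \in S} * {v : V | v \in S}) (B : set (\bar R)),
     measurable B /\ A = [set d | B (d uv)]].

(* The estimates, with the product of the Borel sigma-algebras of \bar R.      *)
Definition outputs (R : realType) (V : finType) (S : {set V}) :=
  g_sigma_algebraType (@cylinders R V S).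

(* A randomized algorithm for the S-pair problem on the public graph (V, E) is *)
(* represented by its output distribution on each weight vector.               *)
Definition algorithm (R : realType) (V : finType) (E : {set {set V}})
    (S : {set V}) : Type :=
  weights R E -> probability (outputs R S) R.

Definition differentially_private (R : realType) (V : finType)
    (E : {set {set V}}) (S : {set V}) (eps delta : R)
    (M : algorithm R E S) : Prop :=
  forall w w' : weights R E, nonneg_weights w -> nonneg_weights w' ->
    neighbors w w' ->
    forall O : set (outputs R S), measurable O ->
      (M w O <= (expR eps)%:E * M w' O + delta%:E)%E.

Definition accurate (R : realType) (V : finType) (E : {set {set V}})
    (S : {set V}) (w : weights R E) (gamma : R) (alpha : \bar R)
    (d : outputs R S) : Prop :=
  forall u v : {x : V | x \in S},
    (dist w (val u) (val v) - alpha <= d (u, v))%E /\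
    (d (u, v) <= gamma%:E * dist w (val u) (val v) + alpha)%E.

(* C k^(3/2) log^(3/2) n sqrt(s^(1 + 1/k) log(1/delta)) / eps, as an extended  *)
(* real: 0^-1 = +oo in \bar R, so that log(1/delta) = +oo at delta = 0 and the *)
(* division by eps = 0 yields +oo whenever the numerator is positive.          *)
Definition additive_error (R : realType) (C : R) (k n s : nat)
    (eps delta : R) : \bar R :=
  (C%:E * (k%:R `^ (3 / 2))%:E * (ln n%:R `^ (3 / 2))%:E
   * (((s%:R : R) `^ (1 + k%:R^-1))%:E * lne (delta%:E^-1)) `^ 2^-1
   / eps%:E)%E.

(* Main.v *)
Require Import Defs.
From mathcomp Require Import all_boot all_order all_algebra.
From mathcomp Require Import all_classical all_reals all_analysis.
From mathcomp Require Import measurable_realfun.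
From mathcomp Require Import zify ring lra.
Import Order.TTheory GRing.Theory Num.Theory.
Import numFieldNormedType.Exports.
Set Implicit Arguments.
Unset Strict Implicit.
Unset Printing Implicit Defensive.

(** The algorithm is a private Thorup-Zwick distance oracle on [S]. Distances are
    rounded down to integers, which keeps their sensitivity at 1. A query [(u, X)]
    returns a vertex [x] of [X] almost nearest to [u], drawn by the exponential
    mechanism, and a noisy value of the distance from [u] to [x]. Starting from
    [A_0 = S], on each level every [u] of [S] peels off its nearest vertices of
    [A_i] one at a time, until its list meets the next level [A_(i+1)]. That level
    is not sampled but built greedily from the answers already revealed: a vertex
    that lies on many long unmet lists is promoted. Charging a promotion to the
    total length of the lists it meets gives [A_k = set0] after
    [O(k |S|^(1+1/k))] queries. A zigzag between [u] and [v] through the levels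
    then yields the stretch [2 k - 1], each of the [k] steps losing the error of
    one query.

    Advanced composition over these adaptive queries costs the square root of their
    number; it is proved by induction on the strategy, with the likelihood ratio of
    the past answers as a parameter. Since no logarithm is lost in the number of
    queries, a factor [sqrt (ln n)] remains, and it covers [delta] close to 1, where
    [ln (1 / delta)] is small; when [1 - delta < 1 / ln n] one may even publish the
    exact distances with probability [delta]. *)

(** * Adaptive query strategies and the level hierarchy *)

(** A decision tree that branches on the returned vertices only; the noisy distances are merely
    recorded. *)
Inductive strategy (V : finType) : Type :=
  | Stop
  | Ask of V & {set V} & (V -> strategy V).
Arguments Stop {V}.

Section Strategies.
Import mathcomp.boot.fintype mathcomp.boot.finset.
Variables (V : finType) (C : V -> {set V}).

Definition query : Type := V * {set V} * V.

(** A worst-case guarantee over all answers, so that the query budget holds surely and not only when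
    the answers are accurate. Transcripts grow at the head. *)
Fixpoint plays (T : nat) (p : strategy V) (t : seq query)
    (Post : seq query -> Prop) {struct p} : Prop :=
  match p, T with
  | Stop, _ => Post t
  | Ask _ _ _, 0 => False
  | Ask u X k, T'.+1 => [/\ X != set0, X \subset C u &
      forall x, x \in X -> plays T' (k x) ((u, X, x) :: t) Post]
  end.

Definition reach (T : nat) (t : seq query) (Post : seq query -> Prop) : Prop :=
  exists p, plays T p t Post.

Lemma reach_stop T t (Post : seq query -> Prop) : Post t -> reach T t Post.
Proof. by move=> tP; exists Stop. Qed.

Lemma reach_ask T t Post u (X : {set V}) : X != set0 -> X \subset C u ->
  (forall x, x \in X -> reach T ((u, X, x) :: t) Post) -> reach T.+1 t Post.
Proof.
move=> X0 XC H.
have /choice[k kP] : forall x, exists p, x \in X -> plays T p ((u, X, x) :: t) Post.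
  move=> x; have [/H[p ?]|] := boolP (x \in X); first by exists p.
  by exists Stop.
by exists (Ask u X k); split.
Qed.

Lemma plays_leq T T' p t Post : T <= T' -> plays T p t Post -> plays T' p t Post.
Proof.
elim: p T T' t => [|u X k IH] [|T] [|T'] t //= TT' [X0 XC H].
by split=> // x xX; apply: IH (H _ xX).
Qed.

Lemma plays_post T p t (Post Post' : seq query -> Prop) :
  (forall t, Post t -> Post' t) -> plays T p t Post -> plays T p t Post'.
Proof.
move=> PP'; elim: p T t => [|u X k IH] [|T] t //=; [exact: PP'|exact: PP'|].
by move=> [X0 XC H]; split=> // x xX; apply: IH (H _ xX).
Qed.

Lemma reach_leq T T' t Post : T <= T' -> reach T t Post -> reach T' t Post.
Proof. by move=> TT' [p pP]; exists p; apply: plays_leq pP. Qed.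

(** A non-adaptive batch. The continuation receives an arbitrary extension [t'] of [t], so that
    later arguments do not depend on the shape of the transcript. *)
Lemma reach_ask_all T (us : seq V) (X : V -> {set V}) t Post : uniq us ->
  {in us, forall u, X u != set0 /\ X u \subset C u} ->
  (forall (x : V -> V) t', {subset t <= t'} ->
     {in us, forall u, x u \in X u /\ (u, X u, x u) \in t'} -> reach T t' Post) ->
  reach (size us + T) t Post.
Proof.
elim: us t => [|u us IH] t /=; first by move=> _ _ H; apply: (H id).
move=> /andP[uus uniq_us] XP H; have [X0 XC] := XP u (mem_head _ _).
rewrite addSn; apply: reach_ask X0 XC _ => y yX.
apply: IH => // [v vus|x t' tt' xP].
  by apply: XP; rewrite in_cons vus orbT.
apply: (H (fun v => if v == u then y else x v)).
  by move=> q qt; apply: tt'; rewrite in_cons qt orbT.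
move=> v; rewrite in_cons; case: eqVneq => [-> _|_ /= /xP//].
by split=> //; apply: tt'; rewrite mem_head.
Qed.

(* [A'] is the next level after [A]: a vertex of [A] that [u] has not listed    *)
(* lost a query of [u] to a vertex of [A'].                                    *)
Definition covers (S A A' : {set V}) (t : seq query) : Prop :=
  forall u w, u \in S -> w \in A :&: C u ->
    (exists X, (u, X, w) \in t) \/
    (exists X p, [/\ (u, X, p) \in t, w \in X & p \in A']).

Lemma covers_sub S A A' t t' : {subset t <= t'} -> covers S A A' t -> covers S A A' t'.
Proof.
move=> tt' H u w uS wA; have [[X /tt'?]|[X [p [/tt'? ? ?]]]] := H _ _ uS wA.
  by left; exists X.
by right; exists X, p.
Qed.

Fixpoint hierarchy (S A : {set V}) (t : seq query) (j : nat) : Prop :=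
  if j is j'.+1 then exists2 A' : {set V}, covers S A A' t & hierarchy S A' t j'
  else A = set0.

(* Each element added to [H] is charged to the lists of size [r] it hits. *)
Lemma saturate (A U H0 : {set V}) (L : V -> {set V}) (r B : nat) : 0 < B ->
  H0 \subset A -> {in U, forall u, #|L u| = r /\ L u \subset A} ->
  exists H : {set V}, [/\ H0 \subset H, H \subset A,
    #|[set u in U | [disjoint L u & H]]| * r ^ 2 <= B &
    #|H| * B + #|A| * (r * #|[set u in U | [disjoint L u & H]]|)
      <= #|H0| * B + #|A| * (r * #|U|)].
Proof.
move=> B0; move: {2}#|U| (leqnn #|U|) => m.
elim: m U H0 => [|m IH] U H0 Um H0A LP.
  have U0 : U = set0 by apply/eqP; rewrite -cards_eq0; lia.
  exists H0; have -> : [set u in U | [disjoint L u & H0]] = set0.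
    by apply/setP => u; rewrite U0 !inE.
  by rewrite U0 cards0; split.
pose U1 := [set u in U | [disjoint L u & H0]].
have U1U : U1 \subset U by apply/subsetP => u; rewrite inE => /andP[].
have U1le := subset_leq_card U1U.
pose cnt x := #|[set u in U1 | x \in L u]|.
(* A heavy vertex pays for itself: promoting it costs [B] and frees [cnt x] lists, each worth
   [#|A| * r]. *)
have [[x xA xB]|nheavy] := pselect (exists2 x, x \in A & B <= cnt x * r * #|A|).
  pose U2 := U1 :\: [set u in U1 | x \in L u].
  have U2card : #|U2| + cnt x = #|U1|.
    rewrite /U2 cardsD; set J := _ :&: _.
    have -> : J = [set u in U1 | x \in L u].
      by apply/setP => u; rewrite !inE; case: (u \in U) => //=; case: disjoint.
    by rewrite subnK// subset_leq_card//; apply/subsetP => u; rewrite inE => /andP[].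
  have cnt0 : 0 < cnt x by case: (cnt x) xB => //; lia.
  have U2U : U2 \subset U by apply: subset_trans U1U; exact: subsetDl.
  have [||H [H0H HA HB Hc]] := IH U2 (x |: H0) _ _ (sub_in1 (subsetP U2U) LP).
  - by lia.
  - by rewrite subUset sub1set xA.
  have xH : x \in H by rewrite (subsetP H0H)// !inE eqxx.
  have sH0H : H0 \subset H by apply: subset_trans H0H; exact: subsetUr.
  have E : [set u in U | [disjoint L u & H]] = [set u in U2 | [disjoint L u & H]].
    apply/setP => u; rewrite !inE; case: (boolP [disjoint L u & H]) => [dH|]; last by rewrite !andbF.
    rewrite (disjointWr sH0H dH) !andbT; case: (u \in U) => //=.
    by case: (boolP (x \in L u)) => // /(disjointFr dH); rewrite xH.
  exists H; rewrite E; split=> //.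
  apply: leq_trans Hc _.
  have : #|x |: H0| <= #|H0|.+1 by rewrite cardsU1; case: (_ \notin _).
  have : #|A| * (r * (#|U2| + cnt x)) <= #|A| * (r * #|U|).
    by rewrite U2card !leq_mul2l U1le !orbT.
  by nia.
exists H0; split=> //; rewrite -/U1; last first.
  by rewrite leq_add2l !leq_mul2l U1le !orbT.
have [A0|A0] := posnP #|A|.
  have /eqP A0' : A == set0 by rewrite -cards_eq0 A0.
  have [->|/set0Pn[u uU1]] := eqVneq U1 set0; first by rewrite cards0.
  have [<-] := LP _ (subsetP U1U _ uU1).
  by rewrite A0' subset0 => /eqP ->; rewrite cards0 expnS !muln0.
(* Double counting: without a heavy vertex, summing [cnt x] over [A] bounds the number of lists not
   hit. *)
have sumE : \sum_(x in A) cnt x = r * #|U1|.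
  transitivity (\sum_(x in A) \sum_(u in U1) (x \in L u)).
    apply: eq_bigr => x _; rewrite /cnt -sum1_card big_mkcond [RHS]big_mkcond /=.
    by apply: eq_bigr => u _; rewrite !inE; do 2 case: (_ \in _) => //=; case: disjoint.
  rewrite exchange_big /= mulnC -sum_nat_const; apply: eq_bigr => u uU1.
  have [<- LA] := LP _ (subsetP U1U _ uU1).
  rewrite -sum1_card big_mkcond [RHS]big_mkcond /=; apply: eq_bigr => x _.
  by case: (boolP (x \in L u)) => [/(subsetP LA)->|]; rewrite ?if_same.
have : \sum_(x in A) cnt x * r * #|A| <= \sum_(x in A) B.
  apply: leq_sum => x xA; apply: ltnW; rewrite ltnNge; apply/negP => ?.
  by apply: nheavy; exists x.
rewrite -!big_distrl /= sumE sum_nat_const; nia.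
Qed.

Section Level.
Variables (S A : {set V}) (b : nat).
Hypotheses (S_gt0 : 0 < #|S|) (b_gt0 : 0 < b).
Let s := #|S|.
Let cand u := A :&: C u.

Definition listed (L : V -> {set V}) (t : seq query) : Prop :=
  forall u x, u \in S -> x \in L u ->
    x \in cand u /\ exists2 X, (u, X, x) \in t & cand u :\: L u \subset X.

(* After [r] rounds, [tau] queries have been asked on this level, [U] is the   *)
(* set of the vertices whose list [L u] is neither hit by [H] nor exhausted.    *)
Definition round_inv (r tau : nat) (U H : {set V}) (L : V -> {set V})
    (t : seq query) : Prop :=
  [/\ U \subset S, H \subset A, listed L t,
   {in U, forall u, [/\ #|L u| = r, L u != cand u & [disjoint L u & H]]} &
   {in S, forall u, u \in U \/ L u = cand u \/ ~~ [disjoint L u & H]}] /\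
  [/\ #|U| * r ^ 2 <= s * b ^ 2,
   #|H| * (s * b ^ 2) + #|A| * (r * #|U|) <= #|A| * tau &
   if r <= b then tau <= s * r else tau * r + 2 * (s * b ^ 2) <= 3 * (s * b * r)].

(** Each query pays [#|A|] and the level takes at most [3 s b] queries, while a promotion costs
    [s b ^ 2]. *)
Lemma round_inv_end r tau H L t : round_inv r tau set0 H L t ->
  #|H| * b <= 3 * #|A| /\ covers S A H t.
Proof.
move=> [[_ HA Lt _ LS] [_ Hc tauP]]; split.
  have tau3 : tau <= 3 * (s * b) by case: (leqP r b) tauP => rb; nia.
  have : #|H| * (s * b ^ 2) <= #|A| * (3 * (s * b)) by nia.
  rewrite (_ : #|H| * (s * b ^ 2) = (#|H| * b) * (s * b)); last by nia.
  rewrite (_ : #|A| * (3 * (s * b)) = (3 * #|A|) * (s * b)); last by nia.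
  by rewrite leq_pmul2r// muln_gt0 S_gt0.
move=> u w uS wA; have [wL|wL] := boolP (w \in L u).
  by left; have [_ [X ? _]] := Lt _ _ uS wL; exists X.
right; have [|[Lc|]] := LS u uS; first by rewrite inE.
  by rewrite Lc wA in wL.
rewrite disjoint_subset => /subsetPn[p pL]; rewrite inE negbK => pH.
have [_ [X Xt /subsetP XP]] := Lt _ _ uS pL.
by exists X, p; split=> //; apply: XP; rewrite inE wL.
Qed.

(** Past round [b] the last bound of the invariant reads [tau <= 3 s b - 2 s b ^ 2 / r]. The at most
    [s b ^ 2 / r ^ 2] lists left cost one query each, which is at most
    [2 s b ^ 2 (1 / r - 1 / r.+1)], so the bound telescopes. *)
Lemma round_inv_step r tau U H L t t' (x : V -> V) : round_inv r tau U H L t ->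
  {subset t <= t'} ->
  {in U, forall u, x u \in cand u :\: L u /\ (u, cand u :\: L u, x u) \in t'} ->
  exists U' H' L', round_inv r.+1 (tau + #|U|) U' H' L' t'.
Proof.
move=> [[US HA Lt UP LS] [Ur Hc tauP]] tt' xP.
pose L' u := if u \in U then x u |: L u else L u.
have L'c u : u \in S -> L' u \subset cand u.
  move=> uS; apply/subsetP => y; rewrite /L'; case: ifPn => [/xP[xu _]|_ /(Lt _ _ uS)[]//].
  rewrite !in_setU in_set1 => /orP[/eqP->|/(Lt _ _ uS)[]//].
  by move: xu; rewrite in_setD => /andP[].
have sb0 : 0 < s * b ^ 2 by rewrite muln_gt0 S_gt0 expn_gt0 b_gt0.
have L'P : {in U, forall u, #|L' u| = r.+1 /\ L' u \subset A}.
  move=> u uU; have [Lr _ _] := UP u uU; split; last first.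
    by apply: subset_trans (subsetIl A (C u)); apply: L'c; apply: (subsetP US).
  rewrite /L' uU cardsU1 Lr; have [] := xP u uU.
  by rewrite in_setD => /andP[-> _].
have [H' [HH' H'A U1r H'c]] := saturate sb0 HA L'P.
set U1 := [set u in U | _] in U1r H'c.
pose U' := [set u in U1 | L' u != cand u].
have U'le : #|U'| <= #|U1|.
  by apply: subset_leq_card; apply/subsetP => u; rewrite inE => /andP[].
have U1le : #|U1| <= #|U|.
  by apply: subset_leq_card; apply/subsetP => u; rewrite inE => /andP[].
have Us : #|U| <= s by apply: subset_leq_card.
exists U', H', L'; split; split=> //.
- by apply/subsetP => u; rewrite !inE => /andP[/andP[/(subsetP US)]].
- move=> u y uS yL'; split; first exact: (subsetP (L'c u uS)).
  move: yL'; rewrite /L'; case: ifPn => [uU|_ yL].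
    rewrite in_setU in_set1 => /orP[/eqP->|yL].
      exists (cand u :\: L u); first by have [] := xP _ uU.
      by apply: setDS; exact: subsetUr.
    have [_ [X Xt XP]] := Lt _ _ uS yL; exists X; first exact: tt'.
    by apply: subset_trans XP; apply: setDS; exact: subsetUr.
  by have [_ [X Xt XP]] := Lt _ _ uS yL; exists X => //; exact: tt'.
- move=> u; rewrite !inE => /andP[/andP[uU dis] nc].
  by split=> //; have [] := L'P u uU.
- move=> u uS; case: (boolP (u \in U')) => [|uU']; [by left|right].
  move: uU'; rewrite in_set negb_and in_set negbK.
  case: (boolP (u \in U)) => uU /=.
    by case/orP => [?|/eqP ?]; [right|left].
  move=> _; have [|[Lc|Ld]] := LS u uS; first by rewrite (negbTE uU).
    by left; rewrite /L' (negbTE uU).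
  right; rewrite /L' (negbTE uU); apply: contra Ld; exact: disjointWr.
- by nia.
- have : r.+1 * #|U'| <= r.+1 * #|U1| by rewrite leq_mul2l U'le orbT.
  by nia.
- case: (ltnP r b) => rb.
    by move: tauP; rewrite ltnW//; nia.
  have tauP' : tau * r + 2 * (s * b ^ 2) <= 3 * (s * b * r).
    move: tauP; case: (leqP r b) => // br tauP.
    have rE : r = b by apply/eqP; rewrite eqn_leq br rb.
    move: tauP; rewrite rE.
    by nia.
  suff : (tau + #|U|) * r.+1 * r + 2 * (s * b ^ 2) * r <= 3 * (s * b * r.+1) * r.
    rewrite -mulnDl leq_pmul2r//; lia.
  have : #|U| * r * r.+1 <= 2 * (s * b ^ 2).
    apply: leq_trans (_ : 2 * (#|U| * r ^ 2) <= _); last by rewrite leq_mul2l Ur orbT.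
    have : r.+1 <= 2 * r by lia.
    by nia.
  have : (tau * r + 2 * (s * b ^ 2)) * r.+1 <= 3 * (s * b * r) * r.+1.
    by rewrite leq_mul2r tauP' orbT.
  by lia.
Qed.

(** [f] is fuel: a list in [U] has [r] elements, all in [A], so no list is left once [r] exceeds
    [#|A|]. *)
Lemma reach_rounds f T Post r tau U H L t : #|A| < r + f -> 
  round_inv r tau U H L t ->
  (forall (H' : {set V}) t', {subset t <= t'} -> #|H'| * b <= 3 * #|A| -> covers S A H' t' ->
     reach T t' Post) ->
  reach (T + (3 * (s * b) - tau)) t Post.
Proof.
elim: f r tau U H L t => [|f IH] r tau U H L t Arf inv cont.
all: have [U0|U0] := eqVneq U set0.
all: try by (move: inv; rewrite U0 => /round_inv_end[Hb Ht];
    apply: reach_leq (cont H t _ Hb Ht); rewrite ?leq_addr).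
  have [[US _ Lt UP _] _] := inv; have /set0Pn[u uU] := U0.
  have [Lr _ _] := UP u uU; have LA : L u \subset A.
    by apply/subsetP => y /(Lt _ _ (subsetP US _ uU))[]; rewrite inE => /andP[].
  by have := subset_leq_card LA; lia.
have [[US HA Lt UP LS] _] := inv.
(* The next batch still fits in the budget, so the truncated subtraction stays exact. *)
have tauU : tau + #|U| <= 3 * (s * b).
  have [_ [Ur _ tauP]] := inv.
  have Us : #|U| <= s by apply: subset_leq_card.
  case: (leqP r b) tauP => rb tauP.
    by have [rltb|] := ltnP r b; nia.
  have : (tau + #|U|) * r <= 3 * (s * b) * r.
    have : #|U| * r <= s * b ^ 2 by nia.
    by nia.
  by rewrite leq_pmul2r//; lia.
have -> : T + (3 * (s * b) - tau) =
    size (enum U) + (T + (3 * (s * b) - (tau + #|U|))) by rewrite -cardE; lia.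
apply: (@reach_ask_all _ _ (fun u => cand u :\: L u)); first exact: enum_uniq.
  move=> u; rewrite mem_enum => uU; have [_ Lc _] := UP u uU; split.
    rewrite setD_eq0; apply: contra Lc => cL; rewrite eqEsubset cL andbT.
    by apply/subsetP => y /(Lt _ _ (subsetP US _ uU))[].
  by apply: subset_trans (subsetDl _ _) (subsetIr _ _).
move=> x t' tt' xP.
have [|U' [H' [L' inv']]] := round_inv_step inv tt' (x := x).
  by move=> u uU; apply: xP; rewrite mem_enum.
apply: (IH _ _ _ _ _ _ _ inv'); first by lia.
by move=> H'' t'' t't''; apply: cont => q /tt' /t't''.
Qed.

Lemma reach_level T t Post :
  (forall (H : {set V}) t', {subset t <= t'} -> #|H| * b <= 3 * #|A| -> covers S A H t' ->
     reach T t' Post) ->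
  reach (T + 3 * (s * b)) t Post.
Proof.
move=> cont; rewrite -(subn0 (3 * _)).
apply: (@reach_rounds #|A|.+1 _ _ 0 0 [set u in S | cand u != set0] set0 (fun=> set0)) => //.
split; split=> //.
- by apply/subsetP => u; rewrite inE => /andP[].
- exact: sub0set.
- by move=> u x; rewrite inE.
- move=> u; rewrite inE eq_sym => /andP[_ ->]; rewrite cards0; split=> //.
  by rewrite disjoints_subset sub0set.
- move=> u uS; rewrite inE uS /=.
  by have [->|] := eqVneq (cand u) set0; [right; left|left].
- by rewrite muln0.
- by rewrite cards0 mul0n.
Qed.

End Level.

(** Each level uses [b = 3 * sg], so that it shrinks at least by the factor [sg]; the strict bound
    [#|A| < sg ^ j] makes the last level empty. *)
Lemma reach_hierarchy (S A : {set V}) (sg j : nat) t Post : 0 < #|S| -> 0 < sg ->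
  #|A| < sg ^ j ->
  (forall t', {subset t <= t'} -> hierarchy S A t' j -> Post t') ->
  reach (j * (9 * (#|S| * sg))) t Post.
Proof.
move=> S0 sg0; elim: j A t => [|j IH] A t Aj cont.
  apply: reach_stop; apply: cont => //=; apply/eqP; rewrite -cards_eq0.
  by rewrite expn0 in Aj; lia.
have -> : j.+1 * (9 * (#|S| * sg)) = j * (9 * (#|S| * sg)) + 3 * (#|S| * (3 * sg)).
  by lia.
apply: (@reach_level S A) => // [|H t' tt' HA cov]; first by lia.
apply: (IH H) => [|t'' t't'' hier].
  have : #|H| * sg < sg ^ j * sg by rewrite -expnSr; lia.
  by rewrite ltn_pmul2r.
apply: cont => [q /tt' /t't''//|]; exists H => //.
exact: covers_sub cov.
Qed.

End Strategies.

Local Open Scope ring_scope.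

(** * Advanced composition *)

Section Moments.
Variable R : realType.

(** A weak form of [cosh y <= exp (y ^ 2 / 2)]: near 0 it follows from [expR x <= 1 + x + 2 x ^ 2]
    for [x <= 1 / 2], and beyond from [y <= 2 y ^ 2]. *)
Lemma cosh_le (y : R) : expR y + expR (- y) <= 2 * expR (2 * y ^+ 2).
Proof.
wlog y0 : y / 0 <= y => [H|].
  have [/H//|/ltW] := leP 0 y; rewrite -oppr_ge0 => /H.
  by rewrite opprK sqrrN addrC.
have [y2|y2] := leP y 2^-1.
  have le_exp (x : R) : x <= 2^-1 -> expR x <= 1 + x + 2 * x ^+ 2.
    move=> x2; rewrite -[x in expR x]opprK expRN.
    have x1 : 0 < 1 - x by lra.
    apply: (@le_trans _ _ (1 - x)^-1).
      by rewrite lef_pV2 ?posrE ?expR_gt0// expR_ge1Dx.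
    rewrite -[leLHS]mul1r ler_pdivrMr//.
    have := sqr_ge0 x; nra.
  have h1 := le_exp _ y2; have h2 : expR (- y) <= 1 + (- y) + 2 * (- y) ^+ 2.
    by apply: le_exp; lra.
  have := expR_ge1Dx (2 * y ^+ 2); nra.
have : expR (- y) <= expR y by rewrite ler_expR; lra.
have : expR y <= expR (2 * y ^+ 2) by rewrite ler_expR; nra.
by lra.
Qed.

(** Convexity of the power function, with the denominator [b - a] of the chord cleared. *)
Lemma expr_le_chord (a b r : R) n : 0 <= a -> a <= r -> r <= b ->
  (b - a) * r ^+ n <= (b - r) * a ^+ n + (r - a) * b ^+ n.
Proof.
move=> a0 ar rb; elim: n => [|n IH]; first by rewrite !expr0; lra.
have r0 : 0 <= r by lra.
have ab : a ^+ n <= b ^+ n by rewrite lerXn2r ?nnegrE//; lra.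
have := ler_wpM2r r0 IH; rewrite !exprS.
have : 0 <= (r - a) * (b - r) * (b ^+ n - a ^+ n).
  by rewrite !mulr_ge0 ?subr_ge0.
by lra.
Qed.

(* The likelihood ratio [p / q] has [q]-mean 1 and takes values in             *)
(* [exp (- tau), exp tau], so its moments are largest at the two endpoints.     *)
Lemma moment_le (I : finType) (B : pred I) (p q : I -> R) (tau : R) (n : nat) :
  0 < tau ->
  (forall i, B i -> [/\ 0 < p i, 0 < q i, p i <= expR tau * q i &
     q i <= expR tau * p i]) ->
  \sum_(i | B i) p i = 1 -> \sum_(i | B i) q i = 1 ->
  \sum_(i | B i) p i * (p i / q i) ^+ n <= expR (2 * (n.+1%:R * tau) ^+ 2).
Proof.
move=> tau0 pq p1 q1; set M := \sum_(i | _) _.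
pose b := expR tau; pose a := expR (- tau).
have a0 : 0 < a by exact: expR_gt0.
have b1 : 1 < b by rewrite /b -expR0 ltr_expR.
have ab1 : a * b = 1 by rewrite -expRD addNr expR0.
have M_chord : (b - a) * M <= (b - 1) * a ^+ n.+1 + (1 - a) * b ^+ n.+1.
  have -> : (b - 1) * a ^+ n.+1 + (1 - a) * b ^+ n.+1 =
      \sum_(i | B i) ((b * q i - p i) * a ^+ n.+1 + (p i - a * q i) * b ^+ n.+1).
    by rewrite big_split /= -!mulr_suml !sumrB -!mulr_sumr p1 q1 !mulr1.
  rewrite mulr_sumr; apply: ler_sum => i Bi; have [pi0 qi0 pq1 pq2] := pq i Bi.
  have -> : (b - a) * (p i * (p i / q i) ^+ n) = q i * ((b - a) * (p i / q i) ^+ n.+1).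
    by rewrite exprS; field; rewrite gt_eqF.
  have -> : (b * q i - p i) * a ^+ n.+1 + (p i - a * q i) * b ^+ n.+1 =
      q i * ((b - p i / q i) * a ^+ n.+1 + (p i / q i - a) * b ^+ n.+1).
    by field; rewrite gt_eqF.
  rewrite ler_pM2l//; apply: expr_le_chord; first exact: ltW.
    by rewrite ler_pdivlMr// mulrC -ler_pdivlMr// /a expRN invrK mulrC.
  by rewrite ler_pdivrMr.
(* From [a b = 1]: [b - a = (b - 1) (1 + a)] and [1 - a = a (b - 1)], so [b - 1] cancels. *)
have M_half : (1 + a) * M <= a ^+ n.+1 + b ^+ n.
  have b10 : 0 < b - 1 by lra.
  rewrite -(ler_pM2l b10).
  have -> : (b - 1) * ((1 + a) * M) = (b - a) * M by ring: ab1.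
  apply: (le_trans M_chord); rewrite le_eqVlt; apply/orP; left; apply/eqP.
  by rewrite !exprS; ring: ab1.
have M0 : 0 <= M.
  apply: sumr_ge0 => i Bi; have [pi0 qi0 _ _] := pq i Bi.
  by rewrite mulr_ge0 ?exprn_ge0 ?divr_ge0 ?ltW.
(* Multiplying by [exp (tau / 2)] symmetrizes the two-point value into [cosh y / cosh (tau / 2)],
   whose denominator is at least 1. *)
pose y := (n%:R + 2^-1) * tau.
pose c := expR (2^-1 * tau).
have cE : c * (1 + a) = expR (2^-1 * tau) + expR (- (2^-1 * tau)).
  by rewrite mulrDr mulr1 -expRD; congr (_ + expR _); field.
have c2 : 2 <= c * (1 + a).
  by rewrite cE; have := expR_ge1Dx (2^-1 * tau); have := expR_ge1Dx (- (2^-1 * tau)); lra.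
have yE : c * (a ^+ n.+1 + b ^+ n) = expR y + expR (- y).
  rewrite mulrDr -!expRM_natl -!expRD addrC /y -natr1.
  by congr (expR _ + expR _); field.
have : 2 * M <= 2 * expR (2 * y ^+ 2).
  apply: le_trans (cosh_le y); rewrite -yE.
  apply: (@le_trans _ _ (c * ((1 + a) * M))); first by rewrite mulrA ler_wpM2r.
  by rewrite ler_wpM2l ?expR_ge0.
rewrite ler_pM2l// => /le_trans; apply; rewrite ler_expR ler_pM2l//.
rewrite lerXn2r ?nnegrE// ?mulr_ge0 ?addr_ge0// ?(ltW tau0)//.
by rewrite ler_wpM2r ?(ltW tau0)// -[n.+1%:R]natr1; lra.
Qed.
End Moments.

(** * The exponential mechanism and cyclic Laplace noise *)

Section ExponentialMechanism.
Variables (R : realType) (I : finType) (B : pred I) (e1 : R).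
Hypothesis e1_gt0 : 0 < e1.

Definition expmech (sc : I -> R) (i : I) : R :=
  expR (- (e1 * sc i)) / \sum_(j | B j) expR (- (e1 * sc j)).

Lemma expmech_norm_gt0 sc i : B i -> 0 < \sum_(j | B j) expR (- (e1 * sc j)).
Proof.
move=> Bi; rewrite (bigD1 i)//= ltr_pwDl ?expR_gt0//.
by apply: sumr_ge0 => j _; exact: expR_ge0.
Qed.

Lemma expmech_gt0 sc i : B i -> 0 < expmech sc i.
Proof. by move=> Bi; rewrite divr_gt0 ?expR_gt0// (expmech_norm_gt0 _ Bi). Qed.

Lemma expmech_sum sc i : B i -> \sum_(j | B j) expmech sc j = 1.
Proof.
by move=> Bi; rewrite -mulr_suml divff// gt_eqF// (expmech_norm_gt0 _ Bi).
Qed.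

(** One [e1] comes from the weight and one from the normalization. *)
Lemma expmech_ratio sc sc' i : (forall j, B j -> `|sc j - sc' j| <= 1) -> B i ->
  expmech sc i <= expR (2 * e1) * expmech sc' i.
Proof.
move=> scP Bi.
have num j : B j -> expR (- (e1 * sc j)) <= expR e1 * expR (- (e1 * sc' j)).
  move=> /scP; rewrite ler_norml => /andP[h1 h2].
  rewrite -expRD ler_expR -subr_ge0.
  rewrite (_ : _ - _ = e1 * (sc j - sc' j - - 1)); last by ring.
  by rewrite mulr_ge0 ?subr_ge0 ?(ltW e1_gt0).
have den : \sum_(j | B j) expR (- (e1 * sc' j)) <=
    expR e1 * \sum_(j | B j) expR (- (e1 * sc j)).
  rewrite mulr_sumr; apply: ler_sum => j /scP; rewrite ler_norml => /andP[h1 h2].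
  rewrite -expRD ler_expR -subr_ge0.
  rewrite (_ : _ - _ = e1 * (1 - (sc j - sc' j))); last by ring.
  by rewrite mulr_ge0 ?subr_ge0 ?(ltW e1_gt0).
have n0 := expmech_norm_gt0 sc Bi; have n0' := expmech_norm_gt0 sc' Bi.
rewrite /expmech mulrA ler_pdivrMr// mulrAC ler_pdivlMr//.
rewrite (_ : 2 * e1 = e1 + e1); last by ring.
rewrite expRD -!mulrA mulrCA.
have := ler_pM (expR_ge0 _) (ltW n0') (num i Bi) den.
by move=> /le_trans; apply; rewrite le_eqVlt; apply/orP; left; apply/eqP; ring.
Qed.

Lemma expmech_tail sc i j (m : R) : B j -> sc j + m <= sc i ->
  expmech sc i <= expR (- (e1 * m)).
Proof.
move=> Bj scij; have n0 := expmech_norm_gt0 sc Bj.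
rewrite ler_pdivrMr//.
apply: (@le_trans _ _ (expR (- (e1 * m)) * expR (- (e1 * sc j)))).
  rewrite -expRD ler_expR -subr_ge0.
  rewrite (_ : _ - _ = e1 * (sc i - (sc j + m))); last by ring.
  by rewrite mulr_ge0 ?subr_ge0 ?(ltW e1_gt0).
rewrite ler_wpM2l ?expR_ge0// (bigD1 j)//= lerDl.
by apply: sumr_ge0 => ? _; exact: expR_ge0.
Qed.

End ExponentialMechanism.

Section CyclicNoise.
Variable h : nat.

(* The representative of [m] modulo [2 h + 1] in [-h, h]. *)
Definition cmod (m : int) : int := ((m + h%:Z) %% (h.*2.+1)%:Z)%Z - h%:Z.

Lemma cmod_bound m : (`|cmod m| <= h)%N.
Proof.
have r0 := modz_ge0 (m + h%:Z) (isT : (h.*2.+1)%:Z != 0).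
have r1 := ltz_pmod (m + h%:Z) (isT : 0 < (h.*2.+1)%:Z).
rewrite /cmod; move: r0 r1; set r := modz _ _; lia.
Qed.

Lemma cmod_succ m : cmod (m + 1) = if cmod m == h%:Z then - h%:Z else cmod m + 1.
Proof.
have r0 := modz_ge0 (m + h%:Z) (isT : (h.*2.+1)%:Z != 0).
have r1 := ltz_pmod (m + h%:Z) (isT : 0 < (h.*2.+1)%:Z).
rewrite /cmod (_ : m + 1 + h%:Z = m + h%:Z + 1); last by ring.
rewrite -(modzDml (m + h%:Z) 1); move: r0 r1; set r := modz _ _ => r0 r1.
case: eqP => hr.
  have -> : r + 1 = (h.*2.+1)%:Z by lia.
  by rewrite modzz sub0r.
by rewrite modz_small; lia.
Qed.

(* A residue [z] drawn with a cyclic Laplace law around [d] lives in a finite   *)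
(* type independent of [d], so its likelihood ratios are bounded everywhere;   *)
(* reading it as the integer nearest to [d] differs between neighbouring       *)
(* inputs only at noise [h] or [- h].                                          *)
Definition cyc_val (d : int) (z : 'I_h.*2.+1) : int := d + cmod (z%:Z - d).

(** Moving the center by one moves the residue one step along the cycle; the wrap between [h] and
    [- h] keeps the absolute value and is the only step at which the decoded integers differ. *)
Lemma cmod_lipschitz (d d' z : int) : `|d - d'| <= 1 ->
  `|(`|cmod (z - d)|%N)%:Z - (`|cmod (z - d')|%N)%:Z| <= 1 /\
  (`|cmod (z - d)|%N != h -> d + cmod (z - d) = d' + cmod (z - d')).
Proof.
move=> dd'; have [->|[->|->]] : d' = d \/ d' = d - 1 \/ d' = d + 1 by lia.
- by split=> //; lia.
- rewrite (_ : z - (d - 1) = z - d + 1); last by ring.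
  by have := cmod_bound (z - d); rewrite cmod_succ; case: eqP; lia.
- rewrite (_ : z - d = z - (d + 1) + 1); last by ring.
  by have := cmod_bound (z - (d + 1)); rewrite cmod_succ; case: eqP; lia.
Qed.

Lemma cmod_reindex (R : nmodType) (F : int -> R) (d : int) :
  \sum_(z < h.*2.+1) F (cmod (z%:Z - d)) = \sum_(j < h.*2.+1) F (j%:Z - h%:Z).
Proof.
pose g (z : 'I_h.*2.+1) : 'I_h.*2.+1 := inord `|((z%:Z - d + h%:Z) %% (h.*2.+1)%:Z)%Z|%N.
have gE z : (g z)%:Z = ((z%:Z - d + h%:Z) %% (h.*2.+1)%:Z)%Z.
  have r0 := modz_ge0 (z%:Z - d + h%:Z) (isT : (h.*2.+1)%:Z != 0).
  have r1 := ltz_pmod (z%:Z - d + h%:Z) (isT : 0 < (h.*2.+1)%:Z).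
  by rewrite /g inordK; lia.
have g_inj : injective g.
  move=> z z' gz; apply/val_inj => /=.
  have : (z%:Z - d + h%:Z) = (z'%:Z - d + h%:Z) %[mod (h.*2.+1)%:Z]%Z.
    by rewrite -!gE gz.
  have := ltn_ord z; have := ltn_ord z'.
  move=> z'h zh /eqP; rewrite !eqz_modDr !modz_small; try lia.
rewrite [RHS](reindex g) /=; last by apply: onW_bij; exact: injF_bij.
by apply: eq_bigr => z _; rewrite gE.
Qed.

Lemma abs_sum_bounds (R : realType) (phi : nat -> R) : (forall i, 0 <= phi i) ->
  \sum_(0 <= i < h.+1) phi i <=
    \sum_(j < h.*2.+1) phi `|j%:Z - h%:Z|%N <= 2 * \sum_(0 <= i < h.+1) phi i.
Proof.
move=> phi0.
rewrite -(big_mkord xpredT (fun j => phi `|j%:Z - h%:Z|%N)).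
rewrite (@big_cat_nat _ _ _ h 0 h.*2.+1)//=; last by lia.
have -> : \sum_(h <= i < h.*2.+1) phi `|i%:Z - h%:Z|%N = \sum_(0 <= i < h.+1) phi i.
  rewrite -{1}[h]add0n big_addn (_ : (h.*2.+1 - h = h.+1)%N); last by lia.
  by apply: eq_bigr => i _; congr phi; lia.
have -> : \sum_(0 <= i < h) phi `|i%:Z - h%:Z|%N = \sum_(1 <= i < h.+1) phi i.
  rewrite [RHS]big_nat_rev /= big_add1 /=.
  by apply: eq_big_nat => i ih; congr phi; lia.
have H0 : 0 <= \sum_(1 <= i < h.+1) phi i by apply: sumr_ge0 => i _.
rewrite lerDr H0 /= mulr2n mulrDl mul1r lerD2r.
by rewrite [leRHS]big_nat_recl// big_add1 lerDr.
Qed.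

Lemma geometric_tail (R : realType) (q : R) (m n : nat) : 0 <= q ->
  \sum_(0 <= i < n) (if (m <= i)%N then q ^+ i else 0) <=
  q ^+ m * \sum_(0 <= i < n) q ^+ i.
Proof.
move=> q0; elim: m => [|m IH]; first by rewrite mul1r.
rewrite exprS -mulrA; apply: le_trans (ler_wpM2l q0 IH).
case: n {IH} => [|n]; first by rewrite !big_nil mulr0.
rewrite big_nat_recl//= add0r [in leRHS]big_nat_recr//= mulrDr mulr_sumr.
rewrite -[leLHS]addr0 lerD//; last by case: ifP => _; rewrite ?mulr0 ?mulr_ge0 ?exprn_ge0.
by apply: ler_sum => i _; rewrite ltnS; case: ifP; rewrite ?mulr0 ?exprS.
Qed.

(** The 2 compares a two-sided tail with a one-sided normalization, both over a truncated geometric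
    series. *)
Lemma cyclic_tail (R : realType) (e1 : R) (d : int) (m : nat) : 0 < e1 ->
  \sum_(z < h.*2.+1 | (m <= `|cmod (z%:Z - d)|)%N)
    expmech xpredT e1 (fun z : 'I_h.*2.+1 => (`|cmod (z%:Z - d)|%N)%:R) z
  <= 2 * expR (- (e1 * m%:R)).
Proof.
move=> e10; pose q := expR (- e1).
have q0 : 0 < q := expR_gt0 _.
have qE (j : nat) : expR (- (e1 * j%:R)) = q ^+ j by rewrite -expRM_natr mulNr.
rewrite /expmech -mulr_suml ler_pdivrMr; last first.
  exact: (@expmech_norm_gt0 _ _ _ _ (fun z : 'I_h.*2.+1 => (`|cmod (z%:Z - d)|%N)%:R) ord0).
under eq_bigr do rewrite qE.
under [X in _ <= _ * X]eq_bigr do rewrite qE.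
rewrite qE big_mkcond /=.
rewrite (cmod_reindex (fun c : int => if (m <= `|c|)%N then q ^+ `|c| else 0)).
rewrite (cmod_reindex (fun c : int => q ^+ `|c|%N)).
have phi0 (i : nat) : 0 <= q ^+ i by rewrite exprn_ge0 ?ltW.
have /andP[lo _] := abs_sum_bounds phi0.
have phim0 (i : nat) : 0 <= (if (m <= i)%N then q ^+ i else 0) by case: ifP.
have /andP[_ hi] := abs_sum_bounds phim0.
apply: (le_trans hi); rewrite -mulrA ler_pM2l//.
apply: (le_trans (geometric_tail _ _ (ltW q0))).
by rewrite ler_wpM2l.
Qed.

End CyclicNoise.

(** * Laws of transcripts: privacy and accuracy along a strategy *)

Section Expectation.
Variables (R : realType) (V : finType) (C : V -> {set V}) (e1 : R) (h : nat).
Hypothesis e1_gt0 : 0 < e1.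
Let noise : finType := 'I_h.*2.+1.

Definition answer : Type := V * {set V} * V * int.
Definition query_of (a : answer) : query V := a.1.

(** The raw answer is a vertex with a residue, whose range does not depend on [D], so that
    likelihood ratios compare pointwise; decoding is left to [expect]. *)
Definition query_kernel (D : V -> V -> int) (u : V) (X : {set V}) (a : V * noise) : R :=
  expmech (mem X) e1 (fun x => (D u x)%:~R) a.1 *
  expmech xpredT e1 (fun z : noise => (`|cmod h (z%:Z - D u a.1)|%N)%:R) a.2.

Fixpoint expect (D : V -> V -> int) (p : strategy V) (t : seq answer)
    (f : seq answer -> R) {struct p} : R :=
  match p with
  | Stop => f t
  | Ask u X k => \sum_(a : V * noise | a.1 \in X) query_kernel D u X a *
      expect D (k a.1) ((u, X, a.1, cyc_val (D u a.1) a.2) :: t) f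
  end.

Lemma kernel_gt0 D u (X : {set V}) (a : V * noise) : a.1 \in X -> 0 < query_kernel D u X a.
Proof. by move=> aX; rewrite mulr_gt0 // expmech_gt0. Qed.

Lemma kernel_ge0 D u (X : {set V}) (a : V * noise) : a.1 \in X -> 0 <= query_kernel D u X a.
Proof. by move=> aX; rewrite ltW ?kernel_gt0. Qed.

Lemma kernel_sum_pair D u (X : {set V}) (P : V -> noise -> bool) :
  \sum_(a : V * noise | (a.1 \in X) && P a.1 a.2) query_kernel D u X a =
  \sum_(x in X) expmech (mem X) e1 (fun x => (D u x)%:~R) x *
    \sum_(z | P x z) expmech xpredT e1 (fun z : noise => (`|cmod h (z%:Z - D u x)|%N)%:R) z.
Proof.
under [RHS]eq_bigr do rewrite mulr_sumr.
by rewrite pair_big_dep.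
Qed.

Lemma kernel_sum D u (X : {set V}) : X != finset.set0 ->
  \sum_(a : V * noise | a.1 \in X) query_kernel D u X a = 1.
Proof.
move=> /finset.set0Pn[x0 x0X].
transitivity (\sum_(a : V * noise | (a.1 \in X) && true) query_kernel D u X a).
  by apply: eq_bigl => a; rewrite andbT.
rewrite (kernel_sum_pair D u X (fun _ _ => true)).
under eq_bigr do rewrite (expmech_sum _ _ (i := ord0))// mulr1.
exact: expmech_sum x0X.
Qed.

(** The choice of the vertex and the noise both have scores of sensitivity 1 and cost [2 * e1]
    each. *)
Lemma kernel_ratio D D' u (X : {set V}) (a : V * noise) : (forall x, `|D u x - D' u x| <= 1) ->
  a.1 \in X -> query_kernel D u X a <= expR (4 * e1) * query_kernel D' u X a.
Proof.
move=> DD' aX; rewrite (_ : 4 * e1 = 2 * e1 + 2 * e1); last by ring.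
rewrite expRD mulrACA ler_pM //.
- by rewrite ltW ?expmech_gt0.
- by rewrite ltW ?expmech_gt0.
- apply: expmech_ratio => // x _.
  by have := DD' x; rewrite -(ler_int R) intr_norm rmorphB.
- apply: expmech_ratio => // z _.
  have [+ _] := cmod_lipschitz h (z : nat) (DD' a.1).
  by rewrite -(ler_int R) intr_norm rmorphB.
Qed.

Lemma kernel_mismatch D D' u (X : {set V}) : (forall x, `|D u x - D' u x| <= 1) ->
  X != finset.set0 ->
  \sum_(a : V * noise | (a.1 \in X) &&
      (cyc_val (D u a.1) a.2 != cyc_val (D' u a.1) a.2)) query_kernel D u X a
  <= 2 * expR (- (e1 * h%:R)).
Proof.
move=> DD' /finset.set0Pn[x0 x0X].
rewrite (kernel_sum_pair D u X (fun x z => cyc_val (D u x) z != cyc_val (D' u x) z)).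
apply: (@le_trans _ _ (\sum_(x in X)
    expmech (mem X) e1 (fun x => (D u x)%:~R) x * (2 * expR (- (e1 * h%:R))))); last first.
  by rewrite -mulr_suml (expmech_sum _ _ x0X) mul1r.
apply: ler_sum => x xX; rewrite ler_wpM2l ?(ltW (expmech_gt0 _ _ _))//.
apply: le_trans (cyclic_tail h (D u x) h e1_gt0).
rewrite [leRHS](bigID (fun z => cyc_val (D u x) z != cyc_val (D' u x) z)) /=.
rewrite -[leLHS]addr0 lerD//; last first.
  by apply: sumr_ge0 => z _; rewrite ltW ?expmech_gt0.
rewrite le_eqVlt; apply/orP; left; apply/eqP; apply: eq_bigl => z.
case: eqP => // /eqP dec; rewrite ?andbF// andbT; apply/esym; rewrite leqNgt.
apply: contra dec => lt; apply/eqP; have [_] := cmod_lipschitz h (z : nat) (DD' x).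
by apply; rewrite neq_ltn lt.
Qed.

(** A union bound: at most [#|V|] vertices are too far, and the tail of the noise contributes the
    2. *)
Lemma kernel_inaccurate D u (X : {set V}) (m : nat) : X != finset.set0 ->
  \sum_(a : V * noise | (a.1 \in X) &&
      ~~ ([forall w in X, D u a.1 <= D u w + m%:Z] &&
          (`|cyc_val (D u a.1) a.2 - D u a.1| <= m)%N)) query_kernel D u X a
  <= (#|V| + 2)%:R * expR (- (e1 * m%:R)).
Proof.
move=> /finset.set0Pn[x0 x0X].
pose far x := ~~ [forall w in X, D u x <= D u w + m%:Z].
pose off x (z : noise) := (m <= `|cmod h (z%:Z - D u x)|)%N.
apply: (@le_trans _ _ (\sum_(a : V * noise | (a.1 \in X) && far a.1) query_kernel D u X a +
    \sum_(a : V * noise | (a.1 \in X) && off a.1 a.2) query_kernel D u X a)).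
  rewrite big_mkcond [X in X + _]big_mkcond [X in _ + X]big_mkcond -big_split /=.
  apply: ler_sum => a _; case: (boolP (a.1 \in X)) => [/kernel_ge0 aX|_] /=; last first.
    by rewrite addr0.
  have := aX D u; rewrite negb_and -/(far a.1); case: (far a.1) => /= k0.
    by rewrite lerDl; case: ifP.
  rewrite add0r; case: ifPn => [|_]; last by case: ifP.
  rewrite /off /cyc_val addrC addKr -ltnNge => /ltnW ->.
  by rewrite lexx.
rewrite natrD mulrDl lerD//.
  rewrite (kernel_sum_pair D u X (fun x _ => far x)).
  apply: (@le_trans _ _ (\sum_(x in X) expR (- (e1 * m%:R)))); last first.
    rewrite sumr_const -[leLHS]mulr_natl ler_wpM2r ?expR_ge0// ler_nat.
    exact: max_card.
  apply: ler_sum => x xX; have [fx|_] := boolP (far x); last first.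
    by rewrite big_pred0// mulr0 expR_ge0.
  rewrite (expmech_sum _ _ (i := ord0))// mulr1.
  move: fx => /forall_inPn[w wX]; rewrite -ltNge => /ltW Dw.
  apply: expmech_tail wX _ => //.
  by move: Dw; rewrite -(ler_int R) intrD.
rewrite (kernel_sum_pair D u X off).
apply: (@le_trans _ _ (\sum_(x in X)
    expmech (mem X) e1 (fun x => (D u x)%:~R) x * (2 * expR (- (e1 * m%:R))))); last first.
  by rewrite -mulr_suml (expmech_sum _ _ x0X) mul1r.
apply: ler_sum => x xX; rewrite ler_wpM2l ?(ltW (expmech_gt0 _ _ _))//.
exact: cyclic_tail.
Qed.

Lemma expect_bounds D p t f T t0 : plays C T p t0 (fun=> True) ->
  (forall t, 0 <= f t <= 1) -> 0 <= expect D p t f <= 1.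
Proof.
move=> + f01; elim: p T t0 t => [|u X k IH] [|T] t0 t //= [X0 _ pl].
apply/andP; split.
  apply: sumr_ge0 => a aX; rewrite mulr_ge0 ?kernel_ge0//.
  by have /andP[] := IH _ _ _ ((u, X, a.1, cyc_val (D u a.1) a.2) :: t) (pl _ aX).
rewrite -(kernel_sum D u X0); apply: ler_sum => a aX.
rewrite -[leRHS]mulr1 ler_wpM2l ?kernel_ge0//.
by have /andP[] := IH _ _ _ ((u, X, a.1, cyc_val (D u a.1) a.2) :: t) (pl _ aX).
Qed.

(* The factor [c] carries the likelihood ratio of the past answers, which is   *)
(* what makes the advanced composition bound provable by induction.            *)
Lemma expect_composition (D D' : V -> V -> int) (lam T : nat) p t t0
    (f : seq answer -> R) (c : R) :
  (forall u x, `|D u x - D' u x| <= 1) ->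
  plays C T p t0 (fun=> True) -> (forall t, 0 <= f t <= 1) -> 0 < c ->
  expect D p t f - c * expect D' p t f <=
    c^-1 ^+ lam * expR (2 * (lam.+1%:R * (4 * e1)) ^+ 2) ^+ T
    + T%:R * (2 * expR (- (e1 * h%:R))).
Proof.
move=> DD' + f01; set G := expR (2 * _); set be := 2 * expR _.
have D'D u x : `|D' u x - D u x| <= 1 by rewrite distrC.
have G1 : 1 <= G by rewrite -expR0 ler_expR mulr_ge0 ?sqr_ge0.
have be0 : 0 <= be by rewrite mulr_ge0 ?expR_ge0.
elim: p T t0 t c => [|u X k IH] T t0 t c.
  move=> _ c0 /=; have /andP[f0 f1] := f01 t.
  rewrite -[leLHS]addr0 lerD ?mulr_ge0//.
  (* For [1 <= c] the difference is nonpositive; for [c < 1] it is at most 1, while the power of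
     [c^-1] is at least 1. *)
  have [c1|c1] := leP 1 c.
    apply: (@le_trans _ _ 0); first by rewrite subr_le0 ler_peMl.
    by rewrite mulr_ge0 ?exprn_ge0 ?invr_ge0 ?(ltW c0) ?expR_ge0.
  apply: (@le_trans _ _ 1).
    by have := mulr_ge0 (ltW c0) f0; lra.
  rewrite -[leLHS]mulr1 ler_pM// exprn_ege1//.
  by rewrite invf_ge1 ?ltW.
case: T => [//|T] /= [X0 _ pl] c0.
pose tr (D : V -> V -> int) (a : V * noise) : seq answer :=
  (u, X, a.1, cyc_val (D u a.1) a.2) :: t.
pose P := query_kernel D u X; pose Q := query_kernel D' u X.
(* The induction hypothesis needs the same transcript in both runs: decoding with [D'] under the law
   of [D] costs the mismatch probability. *)
have swap : \sum_(a : V * noise | a.1 \in X) P a * expect D (k a.1) (tr D a) f <=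
    \sum_(a : V * noise | a.1 \in X) P a * expect D (k a.1) (tr D' a) f + be.
  apply: le_trans (lerD (lexx _) (kernel_mismatch (DD' u) X0)).
  rewrite [X in _ + X]big_mkcondr -big_split /=; apply: ler_sum => a aX.
  case: eqP => dec /=; first by rewrite addr0 /tr dec.
  have /andP[E0 E1] := expect_bounds D (tr D a) (pl _ aX) f01.
  have /andP[E0' E1'] := expect_bounds D (tr D' a) (pl _ aX) f01.
  have P0 := kernel_ge0 D u aX; rewrite -/(P a) in P0 *.
  have := ler_wpM2l P0 E1; have := mulr_ge0 P0 E0'; lra.
have step : \sum_(a : V * noise | a.1 \in X) P a * expect D (k a.1) (tr D' a) f -
    c * \sum_(a : V * noise | a.1 \in X) Q a * expect D' (k a.1) (tr D' a) f <=
    \sum_(a : V * noise | a.1 \in X)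
      (c^-1 ^+ lam * G ^+ T * (P a * (P a / Q a) ^+ lam) + P a * (T%:R * be)).
  rewrite mulr_sumr -sumrB; apply: ler_sum => a aX.
  have P0 := kernel_gt0 D u aX; have Q0 := kernel_gt0 D' u aX.
  rewrite -/(P a) -/(Q a) in P0 Q0.
  (* The likelihood ratio of this answer is absorbed into [c]; averaging its [lam]-th power under
     [P] then gives the factor [G]. *)
  have c'0 : 0 < c * Q a / P a by exact: divr_gt0 (mulr_gt0 c0 Q0) P0.
  have := ler_wpM2l (ltW P0) (IH _ _ _ (tr D' a) _ (pl _ aX) c'0).
  have -> : (c * Q a / P a)^-1 = c^-1 * (P a / Q a).
    by field; rewrite !gt_eqF.
  rewrite exprMn.
  have -> : P a * (expect D (k a.1) (tr D' a) f - c * Q a / P a * expect D' (k a.1) (tr D' a) f)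
     = P a * expect D (k a.1) (tr D' a) f - c * (Q a * expect D' (k a.1) (tr D' a) f).
    by field; rewrite gt_eqF.
  by move=> /le_trans; apply; rewrite le_eqVlt; apply/orP; left; apply/eqP; ring.
rewrite big_split /= -mulr_sumr -mulr_suml in step.
rewrite (kernel_sum D u X0) mul1r in step.
have mom := @moment_le R _ (fun a : V * noise => a.1 \in X) P Q (4 * e1) lam.
have {}mom : \sum_(a : V * noise | a.1 \in X) P a * (P a / Q a) ^+ lam <= G.
  apply: mom; rewrite ?kernel_sum//; first by rewrite mulr_gt0.
  move=> a aX; split; rewrite ?kernel_gt0//; exact: kernel_ratio.
have cG : 0 <= c^-1 ^+ lam * G ^+ T.
  by rewrite mulr_ge0 ?exprn_ge0 ?invr_ge0 ?(ltW c0)// ltW ?expR_gt0.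
have := ler_wpM2l cG mom; rewrite -(mulrA _ (G ^+ T) G) -exprSr => cGM.
rewrite -[T.+1%:R]natr1 mulrDl mul1r addrA.
apply: le_trans (lerD (lerD cGM (lexx _)) (lexx _)).
by move: swap step; rewrite /P /Q /tr; lra.
Qed.

Definition accurate_answer (D : V -> V -> int) (m : nat) (a : answer) : Prop :=
  let: (u, X, x, y) := a in
  [/\ x \in C u, {in X, forall w, D u x <= D u w + m%:Z} & (`|y - D u x| <= m)%N].

(** Each query is charged its own failure probability down the tree; along the surviving branches
    all recorded answers are accurate. *)
Lemma expect_accurate D (m T : nat) p t f Post :
  plays C T p (map query_of t) Post -> (forall t, 0 <= f t <= 1) ->
  (forall t', Post (map query_of t') -> {in t', forall a, accurate_answer D m a} ->
     1 <= f t') ->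
  {in t, forall a, accurate_answer D m a} ->
  1 - T%:R * ((#|V| + 2)%:R * expR (- (e1 * m%:R))) <= expect D p t f.
Proof.
move=> + f01 fP; set be := _ * expR _.
have be0 : 0 <= be by rewrite mulr_ge0 ?expR_ge0.
elim: p T t => [|u X k IH] T t.
  by move=> tP tacc /=; have := fP _ tP tacc; have := mulr_ge0 (ler0n R T) be0; lra.
case: T => [//|T] /= [X0 XC pl] tacc.
pose ok (a : V * noise) := [forall w in X, D u a.1 <= D u w + m%:Z] &&
          (`|cyc_val (D u a.1) a.2 - D u a.1| <= m)%N.
have bad := kernel_inaccurate D u m X0.
have tot := kernel_sum D u X0; rewrite (bigID ok) /= in tot.
apply: (@le_trans _ _ (\sum_(a : V * noise | (a.1 \in X) && ok a)
   query_kernel D u X a * (1 - T%:R * be))).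
  rewrite -mulr_suml -[T.+1%:R]natr1.
  have T0 := mulr_ge0 (ler0n R T) be0.
  have ok1 : \sum_(a : V * noise | (a.1 \in X) && ok a) query_kernel D u X a <= 1.
    rewrite -tot lerDl; apply: sumr_ge0 => a /andP[aX _]; exact: kernel_ge0.
  set K := \sum_(a | _ && _) _ in ok1 tot *.
  rewrite -/be -/ok in bad; move: bad tot; set B := \sum_(a | _ && ~~ _) _ => bad tot.
  have := mulr_ge0 T0 (_ : 0 <= 1 - K); rewrite subr_ge0 => /(_ ok1); lra.
rewrite [leRHS](bigID ok) /= -[leLHS]addr0 lerD//; last first.
  apply: sumr_ge0 => a /andP[aX _]; rewrite mulr_ge0 ?kernel_ge0//.
  have pl' : plays C T (k a.1) ((u, X, a.1) :: map query_of t) (fun=> True).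
    by apply: plays_post (pl _ aX).
  by have /andP[] := expect_bounds D ((u, X, a.1, cyc_val (D u a.1) a.2) :: t) pl' f01.
apply: ler_sum => a /andP[aX /andP[/forall_inP near off]].
rewrite ler_wpM2l ?kernel_ge0//; apply: IH; first exact: pl.
move=> b; rewrite in_cons => /orP[/eqP ->|/tacc//]; split=> //.
by apply: (fintype.subsetP XC).
Qed.

End Expectation.

(** * Graph distances *)

Section Distances.
Variables (R : realType) (V : finType) (E : {set {set V}}).
Implicit Types (w : weights R E) (u v x : V) (p q : seq V).

(** [dist] ranges over simple paths, which do not concatenate; walks do, and [walk_path] cuts them
    down. *)
Definition walk u v p : Prop :=
  path (fun x y => finset.setU [set x]%SET [set y]%SET \in E) u p /\ last u p = v.

Definition component u : {set V} := [set v | `[< exists p, is_path E u v p >]]%SET.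

Definition rdist w u v : R := fine (dist w u v).

Lemma componentP u v : reflect (exists p, is_path E u v p) (v \in component u).
Proof. by rewrite inE; exact: asboolP. Qed.

Lemma step_weight_sym w x y : step_weight w x y = step_weight w y x.
Proof. by rewrite /step_weight finset.setUC. Qed.

Lemma path_weight_cons w u x p :
  path_weight w u (x :: p) = step_weight w u x + path_weight w x p.
Proof. by rewrite /path_weight /= big_cons. Qed.

Lemma path_weight_cat w u p q :
  path_weight w u (p ++ q) = path_weight w u p + path_weight w (last u p) q.
Proof. by rewrite /path_weight pairmap_cat big_cat. Qed.

Lemma path_weight_ge0 w u p : nonneg_weights w -> 0 <= path_weight w u p.
Proof.
move=> w0; elim: p u => [|x p IH] u; first by rewrite /path_weight big_nil.
by rewrite path_weight_cons addr_ge0// /step_weight; case: insub.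
Qed.

Lemma walk_cat u x v p q : walk u x p -> walk x v q -> walk u v (p ++ q).
Proof. by move=> [pp <-] [pq <-]; split; rewrite ?cat_path ?pp ?last_cat. Qed.

Lemma walk_rev w u v p : walk u v p ->
  exists2 q, walk v u q & path_weight w v q = path_weight w u p.
Proof.
elim: p u => [|x p IH] u; first by move=> [_ /= <-]; exists [::].
move=> [/= /andP[ux pp] lp]; have [|q [pq lq] qE] := IH x; first by split.
exists (rcons q u).
  by split; rewrite ?last_rcons// rcons_path pq lq finset.setUC.
rewrite -cats1 path_weight_cat lq qE !path_weight_cons /path_weight big_nil addr0.
by rewrite step_weight_sym addrC.
Qed.

(** A return to [u] closes a loop, which is dropped at no cost as weights are nonnegative. The
    inclusion of [q] in [p] keeps [u] off the shortened tail. *)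
Lemma walk_path w u v p : nonneg_weights w -> walk u v p ->
  exists q, [/\ is_path E u v q, {subset q <= p} & path_weight w u q <= path_weight w u p].
Proof.
move=> w0; have [n] := ubnP (size p); elim: n u p => // n IH u p pn [pp lp].
have [up|up] := boolP (u \in p).
  have /splitPr pE := up; case: pE pn pp lp => p1 p2 pn.
  rewrite cat_path last_cat /= => /andP[_ /andP[_ pp2]] lp2.
  have [||q [qP qs qw]] := IH u p2 _ _; [|by split|].
    by move: pn; rewrite size_cat /=; lia.
  exists q; split=> //.
    by move=> y /qs yp2; rewrite mem_cat in_cons yp2 !orbT.
  apply: (le_trans qw); rewrite path_weight_cat path_weight_cons addrA lerDr.
  by rewrite addr_ge0 ?path_weight_ge0// /step_weight; case: insub.
case: p up pn pp lp => [|x p] up pn; first by move=> _ /= <-; exists [::].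
move=> /= /andP[ux pp] lp; have [||q [[qp qu ql] qs qw]] := IH x p _ _; [by []|by split|].
exists (x :: q); split.
- split=> //=; first by rewrite ux qp.
  rewrite in_cons negb_or; move: up; rewrite in_cons negb_or => /andP[-> up].
  by move: qu => /= ->; rewrite andbT /=; apply: contra up => /qs.
- by move=> y; rewrite !in_cons => /orP[->//|/qs ->]; rewrite orbT.
- by rewrite !path_weight_cons lerD2l.
Qed.

Lemma is_path_walk u v p : is_path E u v p -> walk u v p.
Proof. by case=> ? _ ?; split. Qed.

Lemma component_refl u : u \in component u.
Proof. by apply/componentP; exists [::]; split. Qed.

Let w1 : weights R E := fun=> 0.
Let w1_ge0 : nonneg_weights w1. Proof. by move=> e; rewrite lexx. Qed.

Lemma component_sym u v : v \in component u -> u \in component v.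
Proof.
move=> /componentP[p /is_path_walk /(walk_rev w1)[q /(walk_path w1_ge0)[r [rP _ _]] _]].
by apply/componentP; exists r.
Qed.

Lemma component_trans u x v : x \in component u -> v \in component x ->
  v \in component u.
Proof.
move=> /componentP[p /is_path_walk pw] /componentP[q /is_path_walk qw].
have [r [rP _ _]] := walk_path w1_ge0 (walk_cat pw qw).
by apply/componentP; exists r.
Qed.

Lemma dist_disconnected w u v : v \notin component u -> dist w u v = +oo%E.
Proof.
move=> /componentP uv; rewrite /dist.
set A := (X in ereal_inf X); have -> : A = classical_sets.set0.
  by apply/seteqP; split=> // y [p pP _]; apply: uv; exists p.
exact: ereal_inf0.
Qed.

Lemma distE w u v : nonneg_weights w -> v \in component u ->
  dist w u v = (rdist w u v)%:E.
Proof.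
move=> w0 /componentP[p pP]; rewrite /rdist fineK// fin_real//; apply/andP; split.
  apply: (@lt_le_trans _ _ 0%E); first exact: ltNyr.
  by apply: le_ereal_inf_tmp => _ [q _ <-]; rewrite lee_fin path_weight_ge0.
apply: le_lt_trans (ltry (path_weight w u p)).
by apply: ereal_inf_lbound; exists p.
Qed.

Lemma rdist_le_path w u v p : nonneg_weights w -> is_path E u v p ->
  rdist w u v <= path_weight w u p.
Proof.
move=> w0 pP; rewrite -lee_fin -distE//; last by apply/componentP; exists p.
by apply: ereal_inf_lbound; exists p.
Qed.

Lemma le_rdist w u v (c : R) : nonneg_weights w -> v \in component u ->
  (forall p, is_path E u v p -> c <= path_weight w u p) -> c <= rdist w u v.
Proof.
move=> w0 uv cP; rewrite -lee_fin -distE//.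
by apply: le_ereal_inf_tmp => _ [p /cP pc <-]; rewrite lee_fin.
Qed.

Lemma rdist_le_walk w u v p : nonneg_weights w -> walk u v p ->
  rdist w u v <= path_weight w u p.
Proof.
by move=> w0 /(walk_path w0)[q [qP _ qw]]; apply: le_trans qw; apply: rdist_le_path.
Qed.

Lemma rdist_ge0 w u v : nonneg_weights w -> v \in component u -> 0 <= rdist w u v.
Proof. by move=> w0 uv; apply: le_rdist => // p _; exact: path_weight_ge0. Qed.

Lemma rdist_refl w u : nonneg_weights w -> rdist w u u = 0.
Proof.
move=> w0; apply/eqP; rewrite eq_le rdist_ge0 ?component_refl// andbT.
have := @rdist_le_walk w u u [::] w0; rewrite [path_weight _ _ _]big_nil.
by apply.
Qed.

Lemma rdist_sym_le w u v : nonneg_weights w -> v \in component u ->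
  rdist w v u <= rdist w u v.
Proof.
move=> w0 uv; apply: le_rdist => // p /is_path_walk /(walk_rev w)[q qP <-].
exact: rdist_le_walk.
Qed.

Lemma rdist_sym w u v : nonneg_weights w -> v \in component u ->
  rdist w u v = rdist w v u.
Proof.
move=> w0 uv; apply/le_anti.
by rewrite (rdist_sym_le w0 (component_sym uv)) (rdist_sym_le w0 uv).
Qed.

Lemma rdist_triangle w u x v : nonneg_weights w ->
  x \in component u -> v \in component x ->
  rdist w u v <= rdist w u x + rdist w x v.
Proof.
move=> w0 ux xv; rewrite -lerBlDr; apply: le_rdist => // p /is_path_walk pw.
rewrite lerBlDr addrC -lerBlDr; apply: le_rdist => // q /is_path_walk qw.
rewrite lerBlDr addrC.
have := rdist_le_walk w0 (walk_cat pw qw).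
by rewrite path_weight_cat; case: pw => _ ->.
Qed.

(** No edge repeats on a simple path: the first edge contains [u], which the rest avoids. Hence a
    path weight moves by at most the l1 distance of the weights. *)
Lemma path_edges u p : path (fun x y => finset.setU [set x]%SET [set y]%SET \in E) u p ->
  uniq (u :: p) ->
  exists es : seq {e : {set V} | e \in E}, [/\ uniq es,
    forall w, path_weight w u p = \sum_(e <- es) w e &
    forall e, e \in es -> {subset val e <= u :: p}].
Proof.
elim: p u => [|x p IH] u.
  by move=> _ _; exists [::]; split=> // w; rewrite /path_weight !big_nil.
move=> /= /andP[ux pp] /andP[uxp up]; have [es [esu esw ess]] := IH x pp up.
exists (exist (fun e : {set V} => e \in E) _ ux :: es); split=> [|w|e].
- rewrite /= esu andbT; apply/negP => /ess /(_ u).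
  by rewrite /= !inE eqxx /= => /(_ isT); apply/negP; move: uxp; rewrite in_cons.
- by rewrite path_weight_cons esw big_cons /step_weight insubT.
- rewrite in_cons => /orP[/eqP ->|/ess es_sub] y /=.
    by rewrite !inE => /orP[/eqP->|/eqP->]; rewrite eqxx ?orbT.
  by move=> /es_sub yp; rewrite in_cons yp orbT.
Qed.

Lemma path_weight_neighbors w w' u v p : neighbors w w' -> is_path E u v p ->
  path_weight w u p <= path_weight w' u p + 1.
Proof.
move=> nb [pp pu _]; have [es [esu esw _]] := path_edges pp pu.
rewrite !esw -lerBlDl -sumrB; apply: le_trans nb.
rewrite big_uniq//= [leRHS](bigID (mem es)) /= -[leLHS]addr0 lerD//.
  by apply: ler_sum => e _; exact: ler_norm.
exact: sumr_ge0.
Qed.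

Lemma neighbors_sym w w' : neighbors w w' -> neighbors w' w.
Proof. by rewrite /neighbors; under eq_bigr do rewrite distrC. Qed.

Lemma rdist_neighbors_le w w' u v : nonneg_weights w -> nonneg_weights w' ->
  neighbors w w' -> v \in component u -> rdist w u v <= rdist w' u v + 1.
Proof.
move=> w0 w'0 nb uv; rewrite -lerBlDr; apply: le_rdist => // p pP.
rewrite lerBlDr; apply: le_trans (path_weight_neighbors nb pP).
exact: rdist_le_path.
Qed.

Definition zdist w u v : int := Num.floor (rdist w u v).

(** Rounding down commutes with adding 1 and so keeps the sensitivity; disconnected pairs have the
    value 0 under all weights. *)
Lemma zdist_neighbors w w' u v : nonneg_weights w -> nonneg_weights w' ->
  neighbors w w' -> `|zdist w u v - zdist w' u v| <= 1.
Proof.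
have floor_le (x y : R) : x <= y + 1 -> Num.floor x <= Num.floor y + 1.
  move=> xy; rewrite -lerBlDr floor_ge_int intrB lerBlDr.
  exact: le_trans (floor_le x) xy.
move=> w0 w'0 nb; have [uv|uv] := boolP (v \in component u); last first.
  by rewrite /zdist /rdist !dist_disconnected ?subrr ?normr0.
have h1 := floor_le _ _ (rdist_neighbors_le w0 w'0 nb uv).
have h2 := floor_le _ _ (rdist_neighbors_le w'0 w0 (neighbors_sym nb) uv).
by rewrite /zdist; lia.
Qed.

Lemma zdist_bounds w u v : (zdist w u v)%:~R <= rdist w u v < (zdist w u v)%:~R + 1.
Proof. by have := floor_itv (rdist w u v); rewrite intrD. Qed.

End Distances.

(** * The private distance oracle *)

Section FiniteMixtures.
Context (R : realType) (d : measure_display) (T : measurableType d).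

Lemma mixture_probability (I : finType) (c : I -> R) (P : I -> probability T R) :
  (forall i, 0 <= c i) -> \sum_i c i = 1 ->
  exists Q : probability T R, forall A, Q A = (\sum_i (c i)%:E * P i A)%E.
Proof.
move=> c0 c1.
have [i0|I0] := pickP (mem I); last first.
  by move: c1; rewrite big_pred0 => [/eqP|i]; [rewrite eq_sym oner_eq0|exact: I0].
move=> _; pose x n := nth i0 (enum I) n.
pose mu : {measure set T -> \bar R} := msum (fun n => mscale (NngNum (c0 (x n))) (P (x n))) #|I|.
have muE A : mu A = (\sum_i (c i)%:E * P i A)%E.
  transitivity (\sum_(k < #|I|) (c (x k))%:E * P (x k) A)%E; first by [].
  rewrite -(big_mkord xpredT (fun k => ((c (x k))%:E * P (x k) A)%E)) cardE.
  by rewrite -(big_nth i0 xpredT (fun i => ((c i)%:E * P i A)%E)) big_enum.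
have mu1 : mu [set: T]%classic = 1%E.
  rewrite muE; under eq_bigr do rewrite probability_setT mule1.
  by rewrite sumEFin c1.
exists (mnormalize mu (P i0)) => A; rewrite -muE /= /mnormalize mu1.
by rewrite onee_eq0 /= invr1 mule1.
Qed.

Lemma expect_probability (V : finType) (C : V -> {set V}) (e1 : R) (h N : nat)
    (D : V -> V -> int) p t t0 (out : seq (answer V) -> T) :
  0 < e1 -> plays C N p t0 (fun=> True) ->
  exists Q : probability T R, forall A,
    Q A = (expect e1 h D p t (fun t' => \1_A (out t')))%:E.
Proof.
move=> e10; elim: p N t t0 => [|u X k IH] N t t0.
  by move=> _; exists (dirac (out t)).
case: N => [//|N] /= [X0 _ pl].
have /choice[P PE] : forall a : V * 'I_h.*2.+1, exists Q : probability T R, a.1 \in X ->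
    forall A, Q A = (expect e1 h D (k a.1)
       ((u, X, a.1, cyc_val (D u a.1) a.2) :: t) (fun t' => \1_A (out t')))%:E.
  move=> a; have [aX|aX] := boolP (a.1 \in X).
    by have [Q QE] := IH a.1 N ((u, X, a.1, cyc_val (D u a.1) a.2) :: t) _ (pl _ aX); exists Q.
  by exists (dirac (out t)).
pose c (a : V * 'I_h.*2.+1) := if a.1 \in X then query_kernel e1 D u X a else 0.
have c0 a : 0 <= c a by rewrite /c; case: ifPn => // aX; exact: kernel_ge0.
have c1 : \sum_a c a = 1 by rewrite -big_mkcond kernel_sum.
have [Q QE] := mixture_probability P c0 c1; exists Q => A.
rewrite QE -sumEFin [RHS]big_mkcond /=; apply: eq_bigr => a _.
by rewrite /c; case: ifPn => aX; rewrite ?mul0e// PE.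
Qed.

End FiniteMixtures.

(** * Estimates from a transcript and their stretch *)

Section Estimates.
Variables (R : realType) (V : finType) (E : {set {set V}}) (S : {set V}).

(** Every vertex also knows itself, which is where the zigzag starts. *)
Definition known (t : seq (answer V)) (u x : V) (y : int) : Prop :=
  (exists X, (u, X, x, y) \in t) \/ (x = u /\ y = 0).

(** By the triangle inequality no common known vertex underestimates beyond the noise, so all of
    them may compete with the endpoint of the zigzag. Disconnected pairs share none and get
    [+oo]. *)
Definition estimate (t : seq (answer V)) : outputs R S := fun uv =>
  ereal_inf [set e | exists x y1 y2, [/\ known t (val uv.1) x y1,
    known t (val uv.2) x y2 & e = ((y1 + y2)%:~R)%:E]]%classic.

Section Accuracy.
Variables (w : weights R E) (m : nat) (t : seq (answer V)).
Hypothesis w_ge0 : nonneg_weights w.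
Hypothesis t_acc : {in t, forall a, accurate_answer (component E) (zdist w) m a}.

Lemma known_component u x y : known t u x y -> x \in component E u.
Proof.
case=> [[X /t_acc[]]//|[-> _]]; exact: component_refl.
Qed.

(** The lower side loses one more than [m] to the rounding down. *)
Lemma known_bounds u x y : known t u x y ->
  rdist w u x - m.+1%:R <= y%:~R <= rdist w u x + m%:R.
Proof.
case=> [[X /t_acc[_ _ yP]]|[-> ->]]; last first.
  by rewrite rdist_refl// sub0r add0r oppr_le0 !ler0n.
have /andP[d1 d2] := zdist_bounds w u x.
have yle : y <= zdist w u x + m by lia.
have yge : zdist w u x - m%:Z <= y by lia.
move: yle yge; rewrite -!(ler_int R) intrD intrB -natr1 => yle yge.
by apply/andP; split; lra.
Qed.

Lemma covers_known (A A' : {set V}) v a :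
  covers (component E) S A A' (map (@query_of V) t) -> v \in S -> a \in A ->
  a \in component E v ->
  (exists y, known t v a y) \/
  (exists p y, [/\ p \in A', known t v p y & rdist w v p <= rdist w v a + m.+1%:R]).
Proof.
move=> cov vS aA va; have [|[X]|[X [p [+ aX pA']]]] := cov v a vS.
- by rewrite finset.in_setI aA va.
- by move=> /mapP[[q y] at_ /= qE]; left; exists y; left; exists X; rewrite qE.
move=> /mapP[[q y] at_ /= qE]; rewrite -[q]/(query_of (q, y)) -qE /= in at_.
right; exists p, y; split=> //.
  by left; exists X.
have [_ /(_ a aX) + _] := t_acc at_.
have /andP[_ d2] := zdist_bounds w v p; have /andP[d1 _] := zdist_bounds w v a.
by rewrite -(ler_int R) intrD -natr1 => ?; lra.
Qed.

(** Either [v] knows [a], or it has a pivot [p] on the next level with [rdist w v p <= rdist w u v +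
    rdist w u a + m.+1], and [u] and [v] exchange roles. Doubling this gives the increment of the
    bound per level. *)
Lemma hierarchy_stretch (j : nat) (A : {set V}) u v a :
  hierarchy (component E) S A (map (@query_of V) t) j.+1 -> u \in S -> v \in S ->
  v \in component E u -> a \in A -> (exists y, known t u a y) ->
  exists x y1 y2, [/\ known t u x y1, known t v x y2 &
    rdist w u x + rdist w v x <=
      2 * rdist w u a + (2 * j + 1)%:R * rdist w u v + (2 * j)%:R * m.+1%:R].
Proof.
elim: j A u v a => [|j IH] A u v a [A' cov hier] uS vS uv aA [y0 ua].
all: have au := known_component ua.
all: have va := component_trans R (component_sym R uv) au.
all: have tri : rdist w v a <= rdist w u v + rdist w u a
  by rewrite (rdist_sym w_ge0 uv); apply: rdist_triangle => //; exact: component_sym.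
all: have [[y vy]|[p [y [pA' vp dp]]]] := covers_known cov vS aA va.
- by exists a, y0, y; split=> //; rewrite muln0 mul0r addr0 mul1r; lra.
(* The last level is empty, so it holds no pivot. *)
- by move: hier => /= hier; rewrite hier inE in pA'.
- exists a, y0, y; split=> //.
  have := mulr_ge0 (ler0n R (2 * j.+1)) (ler0n R m.+1).
  have := mulr_ge0 (ler0n R (2 * j.+1)) (rdist_ge0 w_ge0 uv).
  by rewrite natrD mulrDl mul1r; lra.
have vu := component_sym R uv.
have [|x [y1 [y2 [vx ux le_x]]]] := IH A' v u p hier vS uS vu pA'; first by exists y.
exists x, y2, y1; split=> //; rewrite addrC; apply: (le_trans le_x).
rewrite -(rdist_sym w_ge0 uv) (_ : 2 * j.+1 + 1 = (2 * j + 1) + 2)%N; last by lia.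
rewrite (_ : 2 * j.+1 = 2 * j + 2)%N; last by lia.
rewrite [(2 * j + 1 + 2)%:R]natrD [(2 * j + 2)%:R]natrD !mulrDl.
by lra.
Qed.

(** Started at [a = u], the zigzag loses [2 j m.+1], and reading the two noisy values at most [2 m]
    more. *)
Lemma estimate_accurate (j : nat) :
  hierarchy (component E) S S (map (@query_of V) t) j.+1 ->
  accurate w ((2 * j.+1)%:R - 1) ((2 * j.+1)%:R * m.+1%:R)%:E (estimate t).
Proof.
move=> hier [u uS] [v vS]; rewrite /estimate /=.
have m0 : (0 : R) <= m.+1%:R by [].
have jm0 : (0 : R) <= (2 * j)%:R * m.+1%:R by rewrite mulr_ge0.
have jE : (2 * j.+1)%:R = (2 * j)%:R + 2 :> R by rewrite -natrD; congr _%:R; lia.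
have [uv|uv] := boolP (v \in component E u); last first.
  rewrite dist_disconnected//; set B := (X in ereal_inf X).
  have -> : B = classical_sets.set0.
    apply/seteqP; split=> // e [x [y1 [y2 [/known_component ux /known_component vx _]]]].
    by case/negP: uv; apply: (component_trans R ux); exact: (component_sym R vx).
  rewrite ereal_inf0; split; rewrite ?leey//.
  by rewrite gt0_muley ?lte_fin ?jE; [rewrite addye|have := ler0n R (2 * j); lra].
rewrite distE//; split.
  apply: le_ereal_inf_tmp => _ [x [y1 [y2 [ux vx ->]]]].
  rewrite -EFinB lee_fin intrD.
  have /andP[h1 _] := known_bounds ux; have /andP[h2 _] := known_bounds vx.
  have xv : v \in component E x.
    exact: (component_sym R (known_component vx)).
  have := rdist_triangle w_ge0 (known_component ux) xv.
  by rewrite -(rdist_sym w_ge0 (known_component vx)) jE mulrDl; lra.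
have [|x [y1 [y2 [ux vx le_x]]]] := hierarchy_stretch hier uS vS uv uS.
  by exists 0; right.
apply: (@le_trans _ _ ((y1 + y2)%:~R)%:E).
  by apply: ereal_inf_lbound; exists x, y1, y2.
rewrite -EFinM -EFinD lee_fin intrD jE.
have /andP[_ h1] := known_bounds ux; have /andP[_ h2] := known_bounds vx.
move: le_x; rewrite rdist_refl// mulr0 add0r natrD mulrDl mul1r -natr1 => le_x.
rewrite (_ : (2 * j)%:R + 2 - 1 = (2 * j)%:R + 1); last by ring.
by rewrite !mulrDl mul1r; lra.
Qed.

End Accuracy.

Lemma accurate_le (w : weights R E) (g g' : R) (al al' : \bar R) (d : outputs R S) :
  nonneg_weights w -> 0 < g -> g <= g' -> (al <= al')%E -> accurate w g al d ->
  accurate w g' al' d.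
Proof.
move=> w0 g0 gg' alal' acc u v; have [h1 h2] := acc u v; split.
  by apply: le_trans h1; rewrite leeB.
apply: (le_trans h2); rewrite leeD//.
have [uv|uv] := boolP (val v \in component E (val u)).
  by rewrite distE// -!EFinM lee_fin ler_wpM2r ?rdist_ge0.
by rewrite dist_disconnected// !gt0_muley ?lte_fin//; exact: lt_le_trans gg'.
Qed.

End Estimates.

Section Privacy.
Variable R : realType.

Lemma exp1_le4 : expR 1 <= 4 :> R.
Proof.
have h : expR (2^-1) <= 2 :> R.
  rewrite -[2^-1]opprK expRN invf_ple ?posrE ?expR_gt0//.
  by have := expR_ge1Dx (- 2^-1 : R); lra.
have -> : 1 = 2^-1 + 2^-1 :> R by field.
have := expR_ge0 (2^-1 : R).
by rewrite expRD => ?; nra.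
Qed.

(** The source of the threshold 4 on [n]; it also serves [2 / delta] for [delta <= 1 / 2]. *)
Lemma ln_ge1 (x : R) : 4 <= x -> 1 <= ln x.
Proof.
move=> x4; rewrite -[leLHS]expRK ler_ln ?posrE ?expR_gt0//; last by lra.
exact: le_trans exp1_le4 x4.
Qed.

Lemma exists_expR_le (a b : R) : 0 < a -> 0 < b -> exists h : nat, expR (- (a * h%:R)) <= b.
Proof.
move=> a0 b0; exists (Num.truncn (- ln b / a)).+1.
rewrite -[leRHS]lnK ?posrE// ler_expR lerNl -ler_pdivrMl// mulrC.
by rewrite ltW// truncnS_gt.
Qed.

(** An order [lam] just above [2 L / eps] makes the first factor at most [exp (- 2 L)]. The constant
    28 keeps the exponent of the second below [(256 / 784) lam eps], less than half of [lam eps],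
    which leaves [exp (- L) = delta / 2]. *)
Lemma privacy_exponent (T : nat) (eps delta : R) : (0 < T)%N -> 0 < eps -> eps <= 1 ->
  0 < delta -> delta <= 2^-1 ->
  let L := ln (2 / delta) in
  let e1 := eps / (28 * Num.sqrt (T%:R * L)) in
  exists lam : nat,
    (expR eps)^-1 ^+ lam * expR (2 * (lam.+1%:R * (4 * e1)) ^+ 2) ^+ T <= delta / 2.
Proof.
move=> T0 eps0 eps1 d0 d2 L e1.
have L1 : 1 <= L.
  apply: ln_ge1; rewrite ler_pdivlMr//; lra.
have T0' : 0 < T%:R :> R by rewrite ltr0n.
have TL0 : 0 < T%:R * L by rewrite mulr_gt0//; lra.
have e1E : T%:R * e1 ^+ 2 = eps ^+ 2 / (784 * L).
  rewrite /e1 expr_div_n exprMn sqr_sqrtr ?(ltW TL0)//; field.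
  by rewrite !gt_eqF//; lra.
pose lam := (Num.truncn (2 * L / eps)).+1; exists lam.
have lam1 : 2 * L / eps < lam%:R by rewrite truncnS_gt.
have lam2 : lam%:R <= 2 * L / eps + 1.
  by rewrite /lam -natr1 lerD2r truncn_le// divr_ge0//; lra.
have lam3 : 1 <= lam%:R :> R by rewrite ler1n.
rewrite -expRN -!expRM_natl -expRD.
have -> : delta / 2 = expR (- L).
  by rewrite -lnV ?posrE ?divr_gt0// invf_div lnK// posrE divr_gt0.
rewrite ler_expR.
have lamL : 2 * L <= lam%:R * eps by rewrite -ler_pdivrMr// ltW.
have lamS : lam.+1%:R * eps <= 4 * L.
  have : lam%:R * eps <= 2 * L + eps.
    by rewrite -(ler_pM2r eps0) mulrDl mul1r divfK ?gt_eqF// in lam2.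
  by rewrite -[lam.+1%:R]natr1 mulrDl mul1r; lra.
have -> : T%:R * (2 * (lam.+1%:R * (4 * e1)) ^+ 2) =
    (32 / 784) * ((lam.+1%:R * eps) ^+ 2 / L).
  have -> : T%:R * (2 * (lam.+1%:R * (4 * e1)) ^+ 2) =
    32 * lam.+1%:R ^+ 2 * (T%:R * e1 ^+ 2) by ring.
  by rewrite e1E; field; rewrite gt_eqF//; lra.
have : (lam.+1%:R * eps) ^+ 2 / L <= 4 * (lam.+1%:R * eps).
  rewrite ler_pdivrMr; last by lra.
  rewrite expr2 [leRHS]mulrAC ler_wpM2r// mulr_ge0//.
  exact: ltW.
have : lam.+1%:R * eps <= 2 * (lam%:R * eps).
  by rewrite -[lam.+1%:R]natr1 mulrDl mul1r mulr2n mulrDl mul1r lerD2l ler_peMl// ltW.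
by lra.
Qed.

Lemma private_estimates (V : finType) (E : {set {set V}}) (S : {set V})
    (k sg : nat) (eps delta : R) :
  (0 < #|S|)%N -> (#|S| < sg ^ k.+1)%N -> 0 < eps -> eps <= 1 ->
  0 < delta -> delta <= 2^-1 ->
  let T := (k.+1 * (9 * (#|S| * sg)))%N in
  let e1 := eps / (28 * Num.sqrt (T%:R * ln (2 / delta))) in
  exists M : algorithm R E S, differentially_private eps delta M /\
    forall (m : nat) (w : weights R E) (A : set (outputs R S)), nonneg_weights w ->
    (forall d, accurate w ((2 * k.+1)%:R - 1) ((2 * k.+1)%:R * m.+1%:R)%:E d -> A d) ->
    ((1 - T%:R * ((#|V| + 2)%:R * expR (- (e1 * m%:R))))%:E <=
     M w A)%E.
Proof.
move=> S0 Ssg eps0 eps1 d0 d2 T e1.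
have sg0 : (0 < sg)%N by case: sg Ssg {T e1} => //; rewrite exp0n.
have T0 : (0 < T)%N by rewrite !muln_gt0 S0 sg0.
have L1 : 1 <= ln (2 / delta) by apply: ln_ge1; rewrite ler_pdivlMr//; lra.
have e10 : 0 < e1.
  rewrite divr_gt0// mulr_gt0// sqrtr_gt0 mulr_gt0 ?ltr0n//; lra.
pose Post := fun t => hierarchy (component E) S S t k.+1.
have [p pP] : reach (component E) T [::] Post.
  by apply: reach_hierarchy Ssg _ => // t' _.
have pl : plays (component E) T p [::] (fun=> True) by apply: plays_post pP.
have be0 : 0 < delta / (4 * T%:R) by rewrite divr_gt0// mulr_gt0 ?ltr0n.
(* The accuracy bound depends on [m] and not on the noise range [h], which is taken so large that
   all decoding mismatches together cost half of [delta]. *)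
have [h hP] := exists_expR_le e10 be0.
have /choice[M ME] : forall w : weights R E, exists Q : probability (outputs R S) R,
    forall A, Q A = (expect e1 h (zdist w) p [::] (fun t => \1_A (estimate R (S := S) t)))%:E.
  by move=> w; apply: expect_probability pl.
have ind01 (A : set (outputs R S)) (t : seq (answer V)) :
    0 <= (\1_A (estimate R (S := S) t) : R) <= 1.
  by rewrite indicE; case: (_ \in _); rewrite ler01 lexx.
exists M; split=> [w w' w0 w'0 nb O mO|m w A w0 accA].
  rewrite !ME -EFinM -EFinD lee_fin -lerBlDl.
  have [lam lamP] := privacy_exponent T0 eps0 eps1 d0 d2.
  have := expect_composition h e10 lam [::]
    (fun u x => zdist_neighbors u x w0 w'0 nb) pl (ind01 O) (expR_gt0 eps).
  move=> /le_trans; apply.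
  rewrite [leRHS](splitr delta) lerD//.
  apply: (@le_trans _ _ (T%:R * (2 * (delta / (4 * T%:R))))).
    by rewrite !ler_wpM2l.
  by rewrite le_eqVlt; apply/orP; left; apply/eqP; field; rewrite gt_eqF ?ltr0n.
rewrite ME lee_fin; apply: (@expect_accurate _ _ _ _ h e10 _ m _ _ [::] _ Post pP) => //.
move=> t' hier tacc; rewrite indicE mem_set//=.
by apply: accA; exact: estimate_accurate.
Qed.

End Privacy.

(** * Error bounds *)

Local Open Scope classical_set_scope.

Section ErrorBound.
Variable R : realType.

Lemma additive_errorE (C : R) (k n s : nat) (eps delta : R) :
  0 < eps -> 0 < delta -> delta < 1 ->
  additive_error C k n s eps delta =
    (C * k%:R `^ (3 / 2) * ln n%:R `^ (3 / 2)
     * Num.sqrt (s%:R `^ (1 + k%:R^-1) * ln delta^-1) / eps)%:E.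
Proof.
move=> eps0 d0 d1; rewrite /additive_error !inver !gt_eqF//.
rewrite lne_EFin ?invr_gt0// -[X in (X `^ _)%E]EFinM poweR_EFin powR12_sqrt//.
rewrite mulr_ge0 ?powR_ge0//.
by rewrite ln_ge0// invf_ge1// ltW.
Qed.

(** All other factors are positive under these bounds, so no product [0 * +oo] arises. *)
Lemma additive_error_oo (C : R) (k n s : nat) (eps delta : R) :
  0 < C -> (0 < k)%N -> (4 <= n)%N -> (0 < s)%N -> 0 <= eps -> 0 <= delta < 1 ->
  (eps == 0) || (delta == 0) -> additive_error C k n s eps delta = +oo%E.
Proof.
move=> C0 k0 n4 s0 eps0 /andP[d0 d1] ed0; rewrite /additive_error -!EFinM.
have ln1 : 1 <= ln n%:R :> R by apply: ln_ge1; rewrite ler_nat.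
have a0 : (0 < (C * k%:R `^ (3 / 2) * ln n%:R `^ (3 / 2))%:E)%E.
  by rewrite lte_fin !mulr_gt0 ?powR_gt0 ?ltr0n//; lra.
have b0 : (0 < (s%:R `^ (1 + k%:R^-1) : R)%:E)%E by rewrite lte_fin powR_gt0 ?ltr0n.
have [e0|e0] := eqVneq eps 0.
  rewrite e0 inve0 gt0_muley// mule_gt0// poweR_gt0// mule_gt0//.
  rewrite lne_gt0 inver; case: eqVneq => [_|d00]; first by rewrite ltry.
  by rewrite lte_fin invf_gt1// lt_neqAle eq_sym d00.
move: ed0; rewrite (negbTE e0) /= => /eqP ->; rewrite inve0 /lne gt0_muley//.
rewrite poweRyr// gt0_muley// inver (negbTE e0) gt0_mulye// lte_fin invr_gt0.
by rewrite lt_neqAle eq_sym e0.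
Qed.

Variables (k n s : nat) (eps delta : R).
Hypotheses (k_gt0 : (0 < k)%N) (n_ge4 : (4 <= n)%N) (s_gt0 : (0 < s)%N) (s_le : (s <= n)%N).

Let a : R := s%:R `^ k%:R^-1.
Definition branching : nat := (Num.truncn (s%:R `^ k%:R^-1 : R)).+1.

Let s1 : 1 <= s%:R :> R. Proof. by rewrite ler1n. Qed.
Let a1 : 1 <= a. Proof. by rewrite -(powRr0 s%:R) ler_powR// invr_ge0. Qed.
Let a_le : a <= s%:R.
Proof.
by rewrite -[leRHS]powRr1// ler_powR// invf_le1 ?ltr0n// ler1n.
Qed.

Lemma branching_gt : a < branching%:R. Proof. exact: truncnS_gt. Qed.

Lemma branching_le : branching%:R <= 2 * a.
Proof.
have : (Num.truncn a)%:R <= a by rewrite truncn_le (le_trans ler01 a1).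
by have := a1; rewrite /branching -natr1 -/a; lra.
Qed.

Lemma branching_leS : (branching <= s.+1)%N.
Proof.
rewrite ltnS -(ler_nat R); apply: le_trans a_le.
by rewrite truncn_le (le_trans ler01 a1).
Qed.

(** Capping the levels at [s] keeps the number of queries polynomial in [n] for every [k]; for
    [s <= k] the base is at least 2 and [s < 2 ^ s]. *)
Lemma card_lt_branching : (s < branching ^ minn k s)%N.
Proof.
rewrite /minn; case: (ltnP k s) => ks.
  rewrite -(ltr_nat R) natrX.
  have -> : s%:R = a ^+ k.
    rewrite -powR_mulrn ?powR_ge0// /a -powRrM mulVf ?powRr1//.
    by rewrite pnatr_eq0 -lt0n.
  by rewrite ltrXn2r ?branching_gt ?(le_trans ler01 a1)// -lt0n.
apply: (@leq_trans (2 ^ s)); first exact: ltn_expl.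
rewrite leq_exp2r//; have := branching_gt; rewrite -(ltr_nat R) => ?.
exact: le_lt_trans a1 _.
Qed.

Let T : nat := (minn k s * (9 * (s * branching)))%N.
Let delta0 : R := Num.min delta 2^-1.
Let L : R := ln (2 / delta0).
Let e1 : R := eps / (28 * Num.sqrt (T%:R * L)).
Let m : nat := (Num.truncn (9 * ln n%:R / e1)).+1.

Hypotheses (eps_gt0 : 0 < eps) (eps_lt1 : eps < 1).
Hypotheses (delta_gt0 : 0 < delta) (delta_lt1 : delta < 1).
Hypothesis delta_ok : delta <= 2^-1 \/ (ln n%:R)^-1 <= 1 - delta.

Lemma delta0_gt0 : 0 < delta0. Proof. by rewrite lt_min delta_gt0 invr_gt0 ltr0n. Qed.
Lemma delta0_le : delta0 <= 2^-1. Proof. by rewrite ge_min lexx orbT. Qed.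

Let d0 := delta0_gt0.
Let d2 := delta0_le.

Let ln1 : 1 <= ln n%:R :> R. Proof. by apply: ln_ge1; rewrite ler_nat. Qed.
Let L1 : 1 <= L. Proof. by apply: ln_ge1; rewrite ler_pdivlMr//; have := d2; lra. Qed.
Let T1 : 1 <= T%:R :> R. Proof. by rewrite ler1n !muln_gt0 leq_min k_gt0 s_gt0. Qed.

Let TL1 : 1 <= T%:R * L. Proof. by rewrite -[leLHS]mulr1 ler_pM. Qed.
Let sq1 : 1 <= Num.sqrt (T%:R * L).
Proof. by rewrite -[leLHS]sqrtr1 ler_sqrt// (le_trans ler01 TL1). Qed.
Let e1_gt0 : 0 < e1. Proof. by rewrite divr_gt0// mulr_gt0// (lt_le_trans ltr01 sq1). Qed.
Let e1_le1 : e1 <= 1.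
Proof. by have h := sq1; rewrite ler_pdivrMr; have := eps_lt1; lra. Qed.

(** The 9 in [m] brings each tail down to [n ^ -9], against a prefactor of at most [36 n ^ 4]. *)
Lemma failure_bound : T%:R * ((n + 2)%:R * expR (- (e1 * m%:R))) <= (ln n%:R)^-1.
Proof.
have ln_n1 := ln1.
have n0 : 0 < n%:R :> R by rewrite ltr0n; clear -n_ge4; lia.
have expm : expR (- (e1 * m%:R)) <= (n%:R ^+ 9)^-1.
  have -> : n%:R ^+ 9 = expR (9 * ln n%:R) :> R.
    by rewrite mulrC -[9]/(9%:R) expRM_natr lnK ?posrE.
  rewrite -expRN ler_expR lerN2.
  by rewrite -ler_pdivrMl// mulrC ltW// truncnS_gt.
have Tn : T%:R * (n + 2)%:R <= 36 * n%:R ^+ 4 :> R.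
  rewrite -natrX -!natrM ler_nat.
  have h1 : (minn k s <= n)%N by rewrite (leq_trans (geq_minr _ _)).
  have h2 : (branching <= 2 * n)%N by move: branching_leS s_le n_ge4; clear; lia.
  have h3 : (n + 2 <= 2 * n)%N by clear -n_ge4; lia.
  have h4 : (s * branching <= n * (2 * n))%N by rewrite leq_mul.
  have : (T * (n + 2) <= n * (9 * (n * (2 * n))) * (2 * n))%N.
    by rewrite /T !leq_mul.
  move=> /leq_trans; apply; rewrite !expnS expn0; clear; lia.
rewrite mulrA -[leRHS]mul1r ler_pdivlMr; last by lra.
apply: (@le_trans _ _ (36 * n%:R ^+ 4 * (n%:R ^+ 9)^-1 * n%:R)).
  rewrite ler_pM//.
  - by lra.
  - by rewrite ler_pM ?expR_ge0// mulr_ge0.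
  - by rewrite ltW// ln_sublinear.
have -> : 36 * n%:R ^+ 4 * (n%:R ^+ 9)^-1 * n%:R = 36 / n%:R ^+ 4 :> R.
  by field; rewrite gt_eqF.
rewrite ler_pdivrMr ?exprn_gt0// mul1r -natrX ler_nat.
by apply: (@leq_trans (4 ^ 4)) => //; rewrite leq_exp2r.
Qed.

(** The spare factor [ln n] under the root is spent here: when [delta] exceeds [1 / 2], [ln 2 <= 1
    <= ln n * (1 - delta) <= ln n * ln delta^-1]. *)
Let lnV_le : ln delta0^-1 <= ln n%:R * ln delta^-1.
Proof.
have ln_n1 := ln1.
have dV : 0 <= ln delta^-1 by rewrite ln_ge0// invf_ge1// ltW.
have [d12|d12] := leP delta 2^-1.
  by rewrite /delta0 min_l// ler_peMl.
case: delta_ok => [|dn]; first by rewrite leNgt d12.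
rewrite /delta0 (min_r (ltW d12)) invrK.
have ln2 : ln 2 <= 1 :> R.
  by have := @le_ln1Dx R 1 _; rewrite (_ : 1 + 1 = 2)//; apply; lra.
have lnd : 1 - delta <= ln delta^-1.
  rewrite lnV ?posrE// lerNr; have := @le_ln1Dx R (delta - 1).
  by rewrite (_ : 1 + (delta - 1) = delta) ?opprB; [apply; lra|ring].
apply: (le_trans ln2); rewrite -ler_pdivrMl; last by lra.
by rewrite mulr1; exact: le_trans lnd.
Qed.

(* The constant is [2 * 11 * 28 * 6]. *)
Lemma error_bound : (((2 * minn k s)%:R * m.+1%:R)%:E <=
  additive_error 3696 k n s eps delta)%E.
Proof.
have ln_n1 := ln1; have T_1 := T1; have L_1 := L1; have a_1 := a1; have s_1 := s1.
rewrite additive_errorE// lee_fin.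
have pow32 (x : R) : 0 < x -> x `^ (3 / 2) = x * Num.sqrt x.
  move=> x0; rewrite (_ : 3 / 2 = 1 + 2^-1); last by field.
  by rewrite powRD ?powRr1 ?powR12_sqrt ?ltW// (gt_eqF x0) implybT.
rewrite !pow32 ?ltr0n//; last by lra.
set x := s%:R `^ (1 + _).
have xE : x = s%:R * a.
  by rewrite /x powRD ?powRr1// pnatr_eq0 -lt0n s_gt0 implybT.
have x0 : 0 < x by rewrite xE mulr_gt0//; lra.
have K1 : 1 <= k%:R :> R by rewrite ler1n.
have dV : 0 <= ln delta^-1 by rewrite ln_ge0// invf_ge1// ltW.
have T_le : T%:R <= 18 * (k%:R * x).
  rewrite /T !natrM xE.
  have h1 : (minn k s)%:R <= k%:R :> R by rewrite ler_nat geq_minl.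
  have -> : 18 * (k%:R * (s%:R * a)) = k%:R * (9 * (s%:R * (2 * a))) by ring.
  by rewrite !ler_pM ?mulr_ge0// branching_le.
(* As [delta0 <= 1 / 2], [2 / delta0] is at most the square of [delta0^-1]. *)
have L_le : L <= 2 * ln delta0^-1.
  rewrite mulr_natl -lnXn ?invr_gt0// ler_ln ?posrE ?exprn_gt0 ?divr_gt0 ?invr_gt0//.
  by rewrite expr2 ler_pM2r ?invr_gt0// -[leLHS]invrK lef_pV2 ?posrE ?invr_gt0.
have sq_le : Num.sqrt (T%:R * L) <=
    6 * (Num.sqrt k%:R * (Num.sqrt (ln n%:R) * Num.sqrt (x * ln delta^-1))).
  have -> : 6 = Num.sqrt 36 :> R.
    by rewrite (_ : 36 = 6 ^+ 2) ?sqrtr_sqr ?ger0_norm//; ring.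
  rewrite -!sqrtrM//; try by [lra|rewrite ?mulr_ge0//; lra].
  rewrite ler_sqrt; last by rewrite !mulr_ge0//; lra.
  apply: (@le_trans _ _ (18 * (k%:R * x) * (2 * (ln n%:R * ln delta^-1)))); last first.
    by rewrite le_eqVlt; apply/orP; left; apply/eqP; ring.
  rewrite ler_pM//; first by lra.
  by apply: (le_trans L_le); rewrite ler_pM2l.
(* 11 is 9 plus one for each of the two successors, as [ln n / e1] is at least 1. *)
have m_le : m.+1%:R <= 11 * (ln n%:R * e1^-1).
  have e1V : 1 <= e1^-1 by rewrite invf_ge1.
  have : (Num.truncn (9 * ln n%:R / e1))%:R <= 9 * ln n%:R / e1.
    by rewrite truncn_le// !mulr_ge0//; lra.
  have : 1 <= ln n%:R * e1^-1 by rewrite -[leLHS]mulr1 ler_pM.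
  by rewrite /m -!natr1; lra.
apply: (@le_trans _ _ ((2 * k%:R) * (11 * (ln n%:R * e1^-1)))).
  rewrite natrM ler_pM ?mulr_ge0// ler_pM2l// ler_nat; exact: geq_minl.
rewrite /e1 invf_div.
set q := Num.sqrt (x * _) in sq_le *.
have -> : 2 * k%:R * (11 * (ln n%:R * (28 * Num.sqrt (T%:R * L) / eps))) =
    (616 * k%:R * ln n%:R / eps) * Num.sqrt (T%:R * L) by field; rewrite gt_eqF.
have -> : 3696 * (k%:R * Num.sqrt k%:R) * (ln n%:R * Num.sqrt (ln n%:R)) * q / eps =
    (616 * k%:R * ln n%:R / eps) * (6 * (Num.sqrt k%:R * (Num.sqrt (ln n%:R) * q))).
  by field; rewrite gt_eqF.
apply: ler_wpM2l sq_le; apply: divr_ge0 (ltW eps_gt0).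
by apply: mulr_ge0; [apply: mulr_ge0; exact: ler0n|lra].
Qed.

End ErrorBound.

(** The rate [1 / ln n] is dictated by [delta] near 1, where exact distances come out only with
    probability [delta]. Below [n = 4] the claim is void. *)
Definition failure_rate (R : realType) (n : nat) : R := if (n < 4)%N then 1 else (ln n%:R)^-1.

Lemma failure_rate_cvg (R : realType) : failure_rate R n @[n --> \oo] --> (0 : R).
Proof.
apply/cvgrPdist_le => e e0; exists ((Num.truncn (expR e^-1)).+1 + 4)%N => // n /= nN.
rewrite sub0r normrN /failure_rate ifF; last by lia.
have ln1 : 1 <= ln n%:R :> R by apply: ln_ge1; rewrite ler_nat; lia.
rewrite ger0_norm ?invr_ge0; last by lra.
rewrite invf_ple ?posrE//; last by lra.
rewrite -[leLHS]expRK ler_ln ?posrE ?expR_gt0 ?ltr0n//; last by lia.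
apply: ltW; apply: lt_le_trans (truncnS_gt _) _; rewrite ler_nat.
exact: leq_trans (leq_addr _ _) nN.
Qed.

(** * Degenerate parameters and the final case distinction *)

Section TrivialAlgorithms.
Variables (R : realType) (V : finType) (E : {set {set V}}) (S : {set V}) (eps : R).
Hypothesis eps_ge0 : 0 <= eps.

Definition zero_estimates : outputs R S := fun=> 0%E.

Definition constant_algorithm : algorithm R E S := fun=> dirac zero_estimates.

Lemma constant_private delta : 0 <= delta ->
  differentially_private eps delta constant_algorithm.
Proof.
move=> d0 w w' _ _ _ O _; rewrite /constant_algorithm /= /dirac -EFinM -EFinD lee_fin.
rewrite -[leLHS]addr0 lerD// ler_peMl//.
by rewrite -expR0 ler_expR.
Qed.

(** With probability [delta] the output is [f w], and otherwise a constant: only an event of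
    probability [delta] depends on [w]. *)
Lemma mixture_private delta (f : weights R E -> outputs R S) : 0 <= delta <= 1 ->
  exists M : algorithm R E S, differentially_private eps delta M /\
    forall w (A : set (outputs R S)), A (f w) -> (delta%:E <= M w A)%E.
Proof.
move=> /andP[d0 d1]; pose c (b : bool) := if b then delta else 1 - delta.
have c0 b : 0 <= c b by rewrite /c; case: b; lra.
have c1 : \sum_b c b = 1 by rewrite big_bool /=; ring.
have /choice[M ME] : forall w, exists Q : probability (outputs R S) R, forall A,
    Q A = (delta * \1_A (f w) + (1 - delta) * \1_A zero_estimates)%:E.
  move=> w.
  have [Q QE] := @mixture_probability _ _ _ _ c (fun b : bool =>
    dirac (if b then f w else zero_estimates) : probability (outputs R S) R) c0 c1.
  by exists Q => A; rewrite QE big_bool /= /dirac -!EFinM -EFinD.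
have ind01 (A : set (outputs R S)) x : 0 <= (\1_A x : R) <= 1.
  by rewrite indicE; case: (_ \in _); rewrite ler01 lexx.
exists M; split=> [w w' _ _ _ O _|w A Af].
  rewrite !ME -EFinM -EFinD lee_fin.
  have /andP[a0 a1] := ind01 O (f w); have /andP[b0 b1] := ind01 O (f w').
  have /andP[z0 z1] := ind01 O zero_estimates.
  set a := \1_O (f w) in a0 a1 *; set b := \1_O (f w') in b0 b1 *.
  set z := \1_O _ in z0 z1 *.
  have e1 : 1 <= expR eps by rewrite -expR0 ler_expR.
  have Q0 : 0 <= delta * b + (1 - delta) * z by rewrite addr_ge0 ?mulr_ge0//; lra.
  have : delta * b + (1 - delta) * z <= expR eps * (delta * b + (1 - delta) * z).
    by rewrite ler_peMl.
  have := mulr_ge0 d0 b0; have := ler_wpM2l d0 a1; lra.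
rewrite ME lee_fin [\1_A (f w)]indicE mem_set//= mulr1 lerDl.
have /andP[z0 _] := ind01 A zero_estimates; rewrite mulr_ge0//; lra.
Qed.

End TrivialAlgorithms.

(** For disconnected pairs the lower bound rests on the convention that [+oo - +oo] is [-oo]. *)
Lemma accurate_infinite_error (R : realType) (V : finType) (E : {set {set V}}) (S : {set V})
    (w : weights R E) (gamma : R) (d : outputs R S) :
  nonneg_weights w -> 0 < gamma -> accurate w gamma +oo%E d.
Proof.
move=> w0 g0 u v; have [uv|uv] := boolP (val v \in component E (val u)).
  by rewrite distE//; split; rewrite ?leNye ?leey.
by rewrite dist_disconnected// gt0_muley ?lte_fin//; split; rewrite ?leNye ?leey.
Qed.

Definition exact_estimates (R : realType) (V : finType) (E : {set {set V}}) (S : {set V})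
    (w : weights R E) : outputs R S := fun uv => dist w (val uv.1) (val uv.2).

Lemma accurate_exact (R : realType) (V : finType) (E : {set {set V}}) (S : {set V})
    (w : weights R E) (gamma : R) (alpha : \bar R) :
  nonneg_weights w -> 1 <= gamma -> (0 <= alpha)%E ->
  accurate w gamma alpha (@exact_estimates R V E S w).
Proof.
move=> w0 g1 al0 u v; rewrite /exact_estimates /=; have [uv|uv] := boolP (val v \in component E (val u)).
  rewrite distE//; split; first by rewrite geeDl// oppe_le0.
  rewrite -[leLHS]adde0 leeD// -EFinM lee_fin ler_peMl// rdist_ge0//.
rewrite dist_disconnected// gt0_muley ?lte_fin; last by lra.
split; first by rewrite leey.
by rewrite addye// -ltNye (lt_le_trans _ al0)// ltNy0.
Qed.

Lemma stretch_ge1 (R : realType) (k : nat) : (0 < k)%N -> 1 <= (2 * k)%:R - 1 :> R.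
Proof. by move=> k0; rewrite lerBrDr (ler_nat _ 2); lia. Qed.

Theorem theorem5p2 (R : realType) :
  exists C : R, 0 < C /\
  exists eta : nat -> R, eta n @[n --> \oo] --> (0 : R) /\
  forall (k : nat) (eps delta : R),
    (1 <= k)%N -> 0 <= eps < 1 -> 0 <= delta < 1 ->
  forall (V : finType) (E : {set {set V}}) (S : {set V}), edge_set E ->
  exists M : algorithm R E S,
    differentially_private eps delta M /\
    forall w : weights R E, nonneg_weights w ->
      ((1 - eta #|V|)%:E <=
        M w [set d | accurate w ((2 * k)%:R - 1)
               (additive_error C k #|V| #|S| eps delta) d])%E.
Proof.
(* The numeral is hidden behind an equation until the comparison with [error_bound]. *)
have [C C0 CE] : exists2 C : R, 0 < C &
    additive_error C = additive_error (3696 : R) by exists 3696; rewrite ?ltr0n.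
exists C; split=> //; exists (failure_rate R); split; first exact: failure_rate_cvg.
move=> k eps delta k1 /andP[eps0 eps1] /andP[d0 d1] V E S _.
have g1 := stretch_ge1 R k1.
have trivial_case : ((#|V| < 4)%N || (#|S| == 0%N) ||
    (additive_error C k #|V| #|S| eps delta == +oo%E)) ->
    exists M : algorithm R E S, differentially_private eps delta M /\
    forall w : weights R E, nonneg_weights w ->
      ((1 - failure_rate R #|V|)%:E <= M w [set d | accurate w ((2 * k)%:R - 1)
               (additive_error C k #|V| #|S| eps delta) d])%E.
  move=> triv; exists (@constant_algorithm R V E S); split=> [|w w0].
    exact: constant_private.
  case: ltnP triv => [V4 _|V4 /=]; first by rewrite /failure_rate V4 subrr.
  move=> /orP triv; rewrite /constant_algorithm /= /dirac indicE mem_set /=.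
    rewrite lee_fin lerBlDr lerDl /failure_rate ltnNge V4 /= invr_ge0 ln_ge0//.
    by rewrite ler1n (leq_trans _ V4).
  case: triv => [/eqP S0 u|/eqP ->]; last first.
    exact: accurate_infinite_error (lt_le_trans ltr01 g1).
  case: u => u uS; have : (0 < #|S|)%N by apply/card_gt0P; exists u.
  by rewrite S0.
have [/trivial_case//|] := boolP ((#|V| < 4)%N || (#|S| == 0%N) ||
  (additive_error C k #|V| #|S| eps delta == +oo%E)).
rewrite !negb_or -leqNgt -lt0n => /andP[/andP[V4 S0] erry].
have [ed0|] := boolP ((eps == 0) || (delta == 0)).
  by move: erry; rewrite additive_error_oo ?d0 ?eqxx.
rewrite negb_or => /andP[epsn0 dn0] {trivial_case}.
have epsp : 0 < eps by rewrite lt_neqAle eq_sym epsn0.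
have dp : 0 < delta by rewrite lt_neqAle eq_sym dn0.
(* Either releasing the exact distances with probability [delta] already meets the failure rate, or
   [delta] is far enough from 1 for [error_bound]. *)
have [dbig|dok] : (1 - delta < (ln #|V|%:R)^-1) \/
    (delta <= 2^-1 \/ (ln #|V|%:R)^-1 <= 1 - delta).
- by have [|] := leP (ln #|V|%:R)^-1 (1 - delta); [right; right|left].
- have [|M [Mdp Macc]] := @mixture_private R V E S eps eps0 delta (@exact_estimates R V E S).
    by rewrite d0 ltW.
  exists M; split=> // w w0; apply: le_trans (Macc w _ _).
    by rewrite lee_fin /failure_rate ltnNge V4 /=; lra.
  apply: accurate_exact => //; rewrite additive_errorE// lee_fin.
  apply: divr_ge0 eps0; rewrite mulr_ge0 ?sqrtr_ge0// mulr_ge0 ?powR_ge0//.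
  by rewrite mulr_ge0 ?powR_ge0// ltW.
have SV : (#|S| <= #|V|)%N by exact: max_card.
(* The oracle runs with [minn k #|S|] levels; having fewer than [k] only improves the stretch. *)
have k0 : (minn k #|S|).-1.+1 = minn k #|S| by rewrite prednK// leq_min k1.
have Sbr := card_lt_branching R k1 S0; rewrite -k0 in Sbr.
have d00 : 0 < Num.min delta 2^-1 := delta0_gt0 dp.
have [M [Mdp Macc]] := private_estimates E S0 Sbr epsp (ltW eps1) d00 (delta0_le delta).
exists M; split=> [w w' w0 w'0 nb O mO|w w0].
  apply: (le_trans (Mdp w w' w0 w'0 nb O mO)).
  by rewrite leeD2l// lee_fin ge_min lexx.
rewrite k0 in Macc; pose T := (minn k #|S| * (9 * (#|S| * branching R k #|S|)))%N.
pose e1 := eps / (28 * Num.sqrt (T%:R * ln (2 / Num.min delta 2^-1))).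
have fail := failure_bound k1 V4 S0 SV epsp dp.
have err := error_bound k1 V4 S0 epsp eps1 dp d1 dok.
rewrite -/T -/e1 in Macc fail err.

apply: le_trans (Macc (Num.truncn (9 * ln #|V|%:R / e1)).+1 w _ w0 _).
  rewrite lee_fin lerD2l lerN2 /failure_rate ltnNge V4 /=.
  exact: fail.
move=> d; apply: accurate_le => //; last by rewrite CE.
- by apply: lt_le_trans ltr01 (stretch_ge1 _ _); rewrite leq_min k1.
- by rewrite lerD2r ler_nat leq_mul2l geq_minl orbT.
Qed.
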